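(* Fix $a\in(0,1]$. Let $G=(V,\vec E)$ be a finite connected graph (each edge taken with both orientations) rooted at $0$, and let $\mathbf X$ be the directed once-reinforced random walk dORRW($a$) on $G$ started at $0$, with law $\vec{\mathbb P}^{(a)}$. Let $A$ be any measurable subset of the simplex $\{x\in[0,\infty)^V:\sum_ix_i=1\}$ with $A\subset(0,\infty)^V$. Then $$\liminf_{t\to\infty}\frac1t\log\vec{\mathbb P}^{(a)}\left(\tfrac1t\ell(\mathbf X,t)\in A\right)\ge-\inf_{x\in A^o}\mathrm{Dir}(x),$$ $$\limsup_{t\to\infty}\frac1t\log\vec{\mathbb P}^{(a)}\left(\tfrac1t\ell(\mathbf X,t)\in A\right)\le(1-a)\sup_{x\in\overline A}\sum_{i\in V}\deg_i\,x_i-\inf_{x\in\overline A}\mathrm{Dir}(x).$$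
   Context: dORRW($a$): the right-continuous nearest-neighbour continuous-time process with $X_0=0$ which, when at $i$ at time $t$, jumps to a neighbour $j$ at rate $a$ if the oriented edge $(i,j)$ has not been traversed (from $i$ to $j$) by time $t$, and at rate $1$ otherwise. $\ell(\mathbf X,t)_i=\int_0^t\mathbf 1_{\{X_s=i\}}ds$ for $i\in V$. $\deg_i$ is the number of neighbours of $i$. $A^o$ and $\overline A$ are the interior and closure of $A$ relative to the simplex. For $x$ in the simplex, $$\mathrm{Dir}(x):=\sum_{\{i,j\}:\,i\sim j}(\sqrt{x_i}-\sqrt{x_j})^2\ \text{ if all coordinates of } x \text{ are positive},\qquad \mathrm{Dir}(x):=\infty\ \text{ otherwise},$$ where the sum is over unoriented edges, each counted once. Conventions: $\log0=-\infty$, $\inf\emptyset=+\infty$, $\sup\emptyset=-\infty$. *)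

(* Defs.v *)
From HB Require Import structures.
From mathcomp Require Import all_boot all_order all_algebra.
From mathcomp Require Import all_classical all_reals all_analysis.

Set Implicit Arguments.
Unset Strict Implicit.
Unset Printing Implicit Defensive.

Import Order.TTheory GRing.Theory Num.Theory numFieldNormedType.Exports.

Local Open Scope classical_set_scope.
Local Open Scope ring_scope.

Section Paths.
Context {R : realType} {V : finType}.
Implicit Types (x : R -> V) (n : nat) (t : R) (i : V).

(* The [n]-th jump time of a path on [0, +oo), with [jump_time x 0 = 0] and
   [jump_time x n = +oo] if there are fewer than [n] jumps. *)
Fixpoint jump_time x n : \bar R :=
  if n is m.+1 then
    ereal_inf [set t%:E | t in
      [set t | (jump_time x m < t%:E)%E /\
               x t <> x (fine (jump_time x m))]]
  else 0%:E.

(* Meaningful only when [jump_time x n] is finite. *)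
Definition jump_chain x n : V := x (fine (jump_time x n)).

Definition local_time x t : {ptws V -> R} :=
  fun i => \int[lebesgue_measure]_(s in `[0, t]) (x s == i)%:R.

End Paths.

Section DORRW.
Context {R : realType} {V : finType}.
Variables (e : rel V) (o : V) (a : R).
Implicit Types (y : nat -> V) (n : nat) (i j : V).

Definition traversed y n i j : bool :=
  [exists m : 'I_n, (y m == i) && (y m.+1 == j)].

(* Rate of the jump to [j] when the successive positions so far have been
   [y 0, ..., y n]. *)
Definition jump_rate y n j : R :=
  if ~~ e (y n) j then 0 else if traversed y n (y n) j then 1 else a.

Definition exit_rate y n : R := \sum_(j : V) jump_rate y n j.

(* [X] waits at each position for the first of independent exponential clocks,
   one for each neighbour [j] with parameter [jump_rate y n j]: given the past,
   the [n]-th holding time is exponential with parameter [exit_rate y n] and,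
   independently, the next position is [j] with probability
   [jump_rate y n j / exit_rate y n].  The law [dORRW_law] of the first
   positions and holding times is the product of these conditional laws.
   There, the strict inequality for [k] forces [jump_time _ k] to be finite.
   If [V] is a single vertex then [exit_rate y 0 = 0] and the walk never
   jumps. *)
Record is_dORRW d (Omega : measurableType d) (P : probability Omega R)
    (X : R -> Omega -> V) : Prop := {
  dORRW_measurable : forall t i, 0 <= t -> measurable [set w | X t w = i] ;
  dORRW_start : forall w, X 0 w = o ;
  dORRW_right_continuous : forall w t, 0 <= t ->
    \forall s \near t^'+, X s w = X t w ;
  dORRW_law : forall n y (s : nat -> R), y 0%N = o -> (forall k, 0 <= s k) ->
    P [set w | forall k, (k <= n)%N ->
         jump_chain (X^~ w) k = y k /\
         (jump_time (X^~ w) k + (s k)%:E < jump_time (X^~ w) k.+1)%E]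
    = ((\prod_(k < n) (jump_rate y k (y k.+1) / exit_rate y k
                       * expR (- (exit_rate y k * s k))))
       * expR (- (exit_rate y n * s n)))%:E }.

End DORRW.

Section Dirichlet.
Variables (R : realType) (V : finType).

Definition simplex : set {ptws V -> R} :=
  [set x | (forall i, 0 <= x i) /\ \sum_(i : V) x i = 1].

Definition degree (e : rel V) (i : V) : nat := #|[set j | e i j]%SET|.

(* [enum_rank] selects one orientation of each edge. *)
Definition Dir (e : rel V) (x : {ptws V -> R}) : \bar R :=
  if [forall i, 0 < x i] then
    (\sum_(p : V * V | e p.1 p.2 && (enum_rank p.1 < enum_rank p.2)%N)
        (Num.sqrt (x p.1) - Num.sqrt (x p.2)) ^+ 2)%:E
  else +oo%E.

(* Interior and closure relative to the simplex. *)
Definition rel_interior (A : set {ptws V -> R}) : set {ptws V -> R} :=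
  @interior (subspace simplex) A.

Definition rel_closure (A : set {ptws V -> R}) : set {ptws V -> R} :=
  @closure (subspace simplex) A.

End Dirichlet.

(* Main.v *)
(* The proof works along the jumps.  On a fixed history [y 0, ..., y n] of the
   walk the holding times are independent exponential variables, so the
   expectation of [exp (\sum_k c k * hold k)] on that history is the product of
   the factors [jump_rate / (exit_rate - c k)].  Since
   [a * deg <= exit_rate <= deg], since [jump_rate <= 1] and since the value [a]
   is taken at most once per oriented edge, these products are compared with
   those of the simple random walk, up to the factor [exp ((1 - a) t deg)] in the
   upper bound and a constant in the lower one; summing over histories leaves
   powers of the operator [g * nbr_sum].

   Upper bound: for [u > 0] and [c = a * deg - nbr_sum u / u - delta], [u] is a
   supersolution with ratio less than 1, which gives
   [P (c . l_t >= m t) <= C exp (- m t)] (Donsker-Varadhan); taking [u] close to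
   the square root of [x] makes [c . x] close to [(a - 1) deg . x + Dir x], and
   finitely many [u] are enough for all [x].

   Lower bound: for [u = sqrt x] the weight above becomes a probability (Doob
   transform), under which the occupation times after [alpha t] jumps concentrate
   at [t x]; this follows from Chernoff bounds, where the exponential moments are
   controlled by perturbing [u] to first order through a Poisson equation. *)

Require Import Defs.
From mathcomp Require Import all_boot all_order all_algebra.
From mathcomp Require Import all_classical all_reals all_analysis.
From mathcomp Require Import measurable_realfun ring lra.
Import Order.TTheory GRing.Theory Num.Theory numFieldNormedType.Exports.
Local Open Scope classical_set_scope.
Local Open Scope ring_scope.

Set Implicit Arguments.
Unset Strict Implicit.
Unset Printing Implicit Defensive.

Local Arguments jump_time {R V} x n : simpl never.

(** * Exponential moments *)

(** The walk is known only through [dORRW_law], the joint tails of the holding times on each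
    history. Hence a change of measure is always an integral of an explicit weight under [P],
    computed from these tails by Fubini. In the lower bound the weights are [exit_rate - g], with
    [g] a function of the position: in [jump_rate / (exit_rate - c)] the exit rate then cancels, and
    the memory of the walk survives only in the numerators. The other obstacle is the passage from
    jumps to time. In the upper bound, [t] falls inside a holding time, whose last piece needs its
    own weight, and the sum over the number of jumps has to converge; [delta] pays for this. In the
    lower bound the number of jumps is fixed: for the jump rates [u j / u i] the vector [x = u ^+ 2]
    is reversible and [alpha = \sum_i u i * nbr_sum u i] is the mean number of jumps per unit time,
    so that [alpha * t] jumps take a time close to [t]. The Poisson equation does the work of
    differentiating a Perron eigenvalue. *)

Lemma continuous_expRM (R : realType) (c : R) :
  continuous (fun r : R => expR (c * r)).
Proof.
move=> x; apply: continuous_comp; last exact: continuous_expR.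
exact: mulrl_continuous.
Qed.

Lemma integral_expR_itv (R : realType) (c s : R) : c != 0 -> 0 <= s ->
  (\int[lebesgue_measure]_(r in `[0%R, s]) (expR (c * r))%:E
   = ((expR (c * s) - 1) / c)%:E)%E.
Proof.
move=> c0; rewrite le_eqVlt => /predU1P[<-|s0].
  by rewrite mulr0 expR0 subrr mul0r set_itv1 integral_set1.
have dF (x : R) : is_derive x 1 (fun r : R => expR (c * r) / c) (expR (c * x)).
  by apply: is_derive_eq; rewrite /GRing.scale/=; field.
have cF (x : R) : {for x, continuous (fun r : R => expR (c * r) / c)}.
  by apply: differentiable_continuous; apply/derivable1_diffP; case: (dF x).
rewrite (@continuous_FTC2 _ _ (fun r => expR (c * r) / c)) //.
- by rewrite mulr0 expR0 -EFinB -mulrBl.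
- by apply: continuous_subspaceT; exact: continuous_expRM.
- split.
  + by move=> z _; case: (dF z).
  + by apply: cvg_at_right_filter; exact: cF.
  + by apply: cvg_at_left_filter; exact: cF.
- by move=> z _; rewrite derive1E; apply: derive_val.
Qed.

Lemma integral_expRN_itvy (R : realType) (q : R) : 0 < q ->
  (\int[lebesgue_measure]_(r in `[0%R, +oo[) (expR (- q * r))%:E
   = (q^-1)%:E)%E.
Proof.
move=> q0; have := integral_exponential_pdf q0.
rewrite (_ : (fun x => _) = (fun x => (q%:E * (expR (- q * x))%:E)%E)
   \_ `[0%R, +oo[); last first.
  by apply/funext => x; rewrite /exponential_pdf !patchE; case: ifPn.
rewrite -integral_mkcond ge0_integralZl_EFin//; last 2 first.
- apply/measurable_EFinP; apply: measurable_funTS.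
  by apply: continuous_measurable_fun; exact: continuous_expRM.
- exact: ltW.
move=> H; have : ((q^-1)%:E * (q%:E *
    \int[lebesgue_measure]_(r in `[0%R, +oo[) (expR (- q * r))%:E) = (q^-1)%:E)%E.
  by rewrite H mule1.
by rewrite muleA -EFinM mulVf ?gt_eqF// mul1e.
Qed.

Section exponential_moment.
Local Open Scope ereal_scope.
Context d (T : measurableType d) (R : realType).
Variables (P : {finite_measure set T -> \bar R}) (W S : T -> R) (K q : R).
Hypotheses (q_gt0 : (0 < q)%R) (mW : measurable_fun setT W)
  (mS : measurable_fun setT S).
Hypotheses (W_ge0 : forall w, (0 <= W w)%R)
  (S_gt0 : forall w, (0 < W w -> 0 < S w)%R).
Hypothesis W_tail : forall s, (0 <= s)%R ->
  \int[P]_w (W w * \1_[set w | (s < S w)%R] w)%:E = (K * expR (- (q * s)))%:E.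

Let mIcc : measurable [set z : T * R | (0 <= z.2)%R /\ (z.2 < S z.1)%R].
Proof.
apply: measurableI.
  rewrite -[X in measurable X]setTI.
  have : measurable_fun setT (fun z : T * R => (0 <= z.2)%R).
    exact: measurable_fun_ler.
  by move=> /(_ measurableT [set true]); exact.
rewrite -[X in measurable X]setTI.
have : measurable_fun setT (fun z : T * R => (z.2 < S z.1)%R).
  by apply: measurable_fun_ltr => //; apply: measurableT_comp.
by move=> /(_ measurableT [set true]); exact.
Qed.

(** The tail hypothesis at [s = 0] concerns the strict event [0 < S]; by [S_gt0] this event loses no
    mass of [W]. *)
Lemma exponential_total : \int[P]_w (W w)%:E = K%:E.
Proof.
have := W_tail (lexx 0%R); rewrite mulr0 oppr0 expR0 mulr1 => <-.
apply: eq_integral => w _; have := W_ge0 w.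
rewrite le_eqVlt => /predU1P[<-|/S_gt0 S0]; first by rewrite mul0r.
by rewrite indicE mem_set// mulr1.
Qed.

(** [(expR (c * S) - 1) / c] is the integral of [expR (c * r)] over [0 <= r < S]. After exchanging
    the two integrals only the tails of [S] are left. *)
Let tail_moment (c : R) : c != 0%R -> (c < q)%R ->
  \int[P]_w (W w * ((expR (c * S w) - 1) / c))%:E = (K / (q - c))%:E.
Proof.
move=> c0 cq.
pose f (z : T * R) := (W z.1 * expR (c * z.2) *
  \1_[set z : T * R | (0 <= z.2)%R /\ (z.2 < S z.1)%R] z)%:E.
have f0 z : 0 <= f z.
  by rewrite lee_fin mulr_ge0// mulr_ge0 ?expR_ge0.
have mf : measurable_fun setT f.
  apply/measurable_EFinP/measurable_funM; last exact: measurable_indic.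
  apply: measurable_funM; first exact: measurableT_comp.
  apply: measurableT_comp; first exact: measurable_expR.
  exact: measurable_funM.
have mexp D : measurable_fun D (fun r : R => (expR (c * r))%:E).
  apply/measurable_EFinP; apply: measurable_funTS.
  by apply: continuous_measurable_fun; exact: continuous_expRM.
have K_ge0 : (0 <= K)%R.
  by rewrite -lee_fin -exponential_total; apply: integral_ge0 => w _; rewrite lee_fin.
have := fubini_tonelli (m1 := P) (m2 := lebesgue_measure) f mf f0.
rewrite (_ : \int[P]_x _ = \int[P]_w (W w * ((expR (c * S w) - 1) / c))%:E);
  last first.
  apply: eq_integral => w _; have := W_ge0 w.
  rewrite le_eqVlt => /predU1P[W0|W0].
    rewrite -W0 mul0r; apply: integral0_eq => r _.
    by rewrite /f/= -W0 !mul0r.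
  have S0 := S_gt0 W0.
  transitivity ((W w)%:E * \int[lebesgue_measure]_(r in `[0%R, S w[)
      (expR (c * r))%:E).
    rewrite -ge0_integralZl_EFin//; last exact: mexp.
    rewrite [RHS]integral_mkcond; apply: eq_integral => r _.
    rewrite /f patchE/=; case: ifPn => [|] hr.
      by rewrite indicE mem_set ?mulr1 ?EFinM//; move: hr; rewrite inE/= in_itv/= => /andP.
    rewrite indicE memNset ?mulr0//=; move/negP: hr; rewrite inE/= in_itv/= => hr.
    by case=> a b; apply: hr; rewrite a b.
  by rewrite integral_itv_bndo_bndc ?integral_expR_itv ?(ltW S0)//; exact: mexp.
move=> ->.
transitivity (\int[lebesgue_measure]_(r in `[0%R, +oo[)
    (K%:E * (expR (- (q - c) * r))%:E)).
  rewrite [RHS]integral_mkcond; apply: eq_integral => r _.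
  rewrite patchE/=; case: ifPn => [|] hr; last first.
    apply: integral0_eq => w _; rewrite /f indicE memNset/= ?mulr0//.
    by case=> r0 _; move/negP: hr; apply; rewrite inE/= in_itv/= r0.
  have r0 : (0 <= r)%R by move: hr; rewrite inE/= in_itv/= andbT.
  transitivity (\int[P]_w ((expR (c * r))%:E * (W w * \1_[set w | (r < S w)%R] w)%:E)).
    apply: eq_integral => w _; rewrite /f -EFinM; congr _%:E.
    rewrite !indicE/= (_ : ((w, r) \in _) = (w \in [set w0 | (r < S w0)%R])).
      by rewrite mulrCA mulrA.
    by apply/idP/idP; rewrite !inE/= => // -[].
  rewrite ge0_integralZl_EFin ?W_tail ?expR_ge0//.
  - rewrite -!EFinM mulrCA -expRD; congr (_ * expR _)%:E; ring.
  - by move=> w _; rewrite lee_fin mulr_ge0.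
  - apply/measurable_EFinP/measurable_funM => //; apply: measurable_indic.
    rewrite -[X in measurable X]setTI.
    have : measurable_fun setT (fun w => (r < S w)%R) by exact: measurable_fun_ltr.
    by move=> /(_ measurableT [set true]); exact.
rewrite ge0_integralZl_EFin//.
- by rewrite integral_expRN_itvy// subr_gt0.
- apply/measurable_EFinP; apply: measurable_funTS.
  by apply: continuous_measurable_fun; exact: continuous_expRM.
Qed.

(* For [c < 0] the identity [exp(cS) + (-c) (exp(cS) - 1) / c = 1] is integrated
   instead, so that only nonnegative functions occur. *)
Lemma exponential_moment (c : R) : (c < q)%R ->
  \int[P]_w (W w * expR (c * S w))%:E = (K * q / (q - c))%:E.
Proof.
move=> cq; have qc0 : (q - c != 0)%R by rewrite subr_eq0 gt_eqF.
have [->|c0] := eqVneq c 0%R.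
  under eq_integral do rewrite mul0r expR0 mulr1.
  by rewrite exponential_total subr0 mulfK// gt_eqF.
have E0 w : (0 <= W w * ((expR (c * S w) - 1) / c))%R.
  have := W_ge0 w; rewrite le_eqVlt => /predU1P[<-|W0]; first by rewrite mul0r.
  rewrite mulr_ge0//; have S0 := S_gt0 W0.
  have [cn|cp|ce] := ltgtP c 0%R; last by rewrite ce eqxx in c0.
    rewrite mulr_le0//; last by rewrite invr_le0 ltW.
    by rewrite subr_le0 -expR0 ler_expR mulr_le0_ge0 ?ltW.
  rewrite divr_ge0//; last exact: ltW.
  by rewrite subr_ge0 -expR0 ler_expR mulr_ge0 ?ltW.
have mexp : measurable_fun setT (fun w => expR (c * S w)).
  apply: measurableT_comp; first exact: measurable_expR.
  exact: measurable_funM.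
have mE : measurable_fun setT (fun w => W w * ((expR (c * S w) - 1) / c))%R.
  by apply: measurable_funM => //; apply: measurable_funM => //; exact: measurable_funB.
have E1 w : (0 <= W w * expR (c * S w))%R by rewrite mulr_ge0 ?expR_ge0.
have E0' w : setT w -> 0 <= (W w * ((expR (c * S w) - 1) / c))%:E.
  by rewrite lee_fin.
have E1' w : setT w -> 0 <= (W w * expR (c * S w))%:E by rewrite lee_fin.
have mE' := (measurable_EFinP _ _).2 mE.
have mF : measurable_fun setT (fun w => (W w * expR (c * S w))%:E).
  exact/measurable_EFinP/measurable_funM.
have [cn|cp|ce] := ltgtP c 0%R; last by rewrite ce eqxx in c0.
  have : \int[P]_w ((W w * expR (c * S w))%:E
      + (- c)%:E * (W w * ((expR (c * S w) - 1) / c))%:E) = K%:E.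
    rewrite -exponential_total; apply: eq_integral => w _.
    rewrite -EFinM -EFinD; congr _%:E; field.
    by rewrite c0.
  have c_ge0 : (0 <= - c)%R by rewrite oppr_ge0 ltW.
  rewrite ge0_integralD//; last 2 first.
  - by move=> w _; rewrite mule_ge0 ?lee_fin.
  - exact: measurable_funeM.
  rewrite ge0_integralZl_EFin ?tail_moment//.
  case: (\int[P]_w (W w * expR (c * S w))%:E) => [r| |]//=.
  rewrite -EFinM -EFinD => -[h]; congr _%:E.
  have -> : (r = K + c * (K / (q - c)))%R by rewrite -[X in (X + _)%R]h; ring.
  by field.
transitivity (\int[P]_w ((W w)%:E
    + c%:E * (W w * ((expR (c * S w) - 1) / c))%:E)).
  apply: eq_integral => w _; rewrite -EFinM -EFinD; congr _%:E; field.
  by rewrite c0.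
rewrite ge0_integralD//; last 4 first.
- by move=> w _; rewrite lee_fin.
- exact/measurable_EFinP.
- by move=> w _; rewrite mule_ge0 ?lee_fin ?(ltW cp).
- exact: measurable_funeM.
rewrite ge0_integralZl_EFin ?tail_moment ?exponential_total ?(ltW cp)//.
by rewrite -EFinM -EFinD; congr _%:E; field.
Qed.

End exponential_moment.

Lemma measurable_lt_fun d (T : measurableType d) (R : realType) (f : T -> R)
  (r : R) : measurable_fun setT f -> measurable [set w | r < f w].
Proof.
move=> mf; rewrite -[X in measurable X]setTI.
have : measurable_fun setT (fun w => r < f w) by exact: measurable_fun_ltr.
by move=> /(_ measurableT [set true]); exact.
Qed.

Section exponential_product_moment.
Context d (T : measurableType d) (R : realType).
Variables (P : {finite_measure set T -> \bar R}) (n : nat) (D : set T)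
  (S : nat -> T -> R) (K : R) (q c : nat -> R).
Hypotheses (mD : measurable D) (mS : forall k, measurable_fun setT (S k))
  (q_gt0 : forall k, (k < n)%N -> 0 < q k)
  (c_lt : forall k, (k < n)%N -> c k < q k)
  (S_gt0 : forall w k, D w -> (k < n)%N -> 0 < S k w).
Hypothesis D_tail : forall s : nat -> R, (forall k, 0 <= s k) ->
  P (D `&` [set w | forall k, (k < n)%N -> s k < S k w])
  = (K * \prod_(k < n) expR (- (q k * s k)))%:E.

Let tail m (s : nat -> R) : set T :=
  D `&` [set w | forall k, (m <= k < n)%N -> s k < S k w].

Let mtail m s : measurable (tail m s).
Proof.
apply: measurableI => //.
have -> : [set w | forall k, (m <= k < n)%N -> s k < S k w] =
    \bigcap_(k in [set k | (m <= k < n)%N]) [set w | s k < S k w].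
  by apply/seteqP; split.
by apply: bigcap_measurableType => k _; exact: measurable_lt_fun.
Qed.

Let W m s w := expR (\sum_(k < m) c k * S k w) * \1_(tail m s) w.

(** Interpolates between tails and moments: the first [m] variables carry their exponential weight,
    the others are still constrained from below. The step from [m] to [m.+1] is the one-variable
    lemma, applied to the weight formed by all the other variables. *)
Let partial_moment m s : (m <= n)%N -> (forall k, 0 <= s k) ->
  (\int[P]_w (W m s w)%:E = (K * (\prod_(k < m) (q k / (q k - c k)) *
     \prod_(m <= k < n) expR (- (q k * s k))))%:E)%E.
Proof.
elim: m s => [|m IH] s mn s0.
  rewrite big_ord0 mul1r big_mkord.
  under eq_integral do rewrite /W big_ord0 expR0 mul1r.
  rewrite integral_indic// setIT -D_tail//; congr (P _); rewrite /tail; congr (_ `&` _).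
pose U w := expR (\sum_(k < m) c k * S k w) * \1_(tail m.+1 s) w.
have mU : measurable_fun setT U.
  apply: measurable_funM; last exact: measurable_indic.
  apply: measurableT_comp; first exact: measurable_expR.
  by apply: measurable_sum => k; exact: measurable_funM.
have U0 w : 0 <= U w by rewrite mulr_ge0 ?expR_ge0.
have US w : 0 < U w -> 0 < S m w.
  rewrite /U indicE; case: (boolP (w \in tail m.+1 s)); last by rewrite mulr0 ltxx.
  by rewrite inE => -[Dw _] _; exact: S_gt0.
pose K' := K * (\prod_(k < m) (q k / (q k - c k)) *
   \prod_(m.+1 <= k < n) expR (- (q k * s k))).
have Utail r : 0 <= r ->
    (\int[P]_w (U w * \1_[set w | (r < S m w)%R] w)%:E
     = (K' * expR (- (q m * r)))%:E)%E.
  (* Putting [r] in place of [s m] turns the tail of [S m] under the weight [U] into an instance of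
     the induction hypothesis. *)
  move=> r0; pose s' k := if k == m then r else s k.
  have s'0 k : 0 <= s' k by rewrite /s'; case: ifP.
  transitivity (\int[P]_w (W m s' w)%:E)%E.
    apply: eq_integral => w _; congr _%:E; rewrite /U /W -mulrA; congr *%R.
    suff -> : tail m s' = tail m.+1 s `&` [set w | r < S m w] by rewrite indicI.
    apply/esym/seteqP; split => z /=.
      move=> [[Dz h] rz]; split => // k /andP[]; rewrite leq_eqVlt /s'.
      move=> /predU1P[<-|mk kn]; first by rewrite eqxx.
      by rewrite gtn_eqF// h// mk.
    move=> [Dz h]; split; last by have := h m; rewrite leqnn mn /s' eqxx; exact.
    split => // k /andP[mk kn]; have := h k; rewrite (ltnW mk) kn => /(_ isT).
    by rewrite /s' gtn_eqF.
  rewrite IH// ?(ltnW mn)//; congr _%:E; rewrite /K' -!mulrA; congr (_ * (_ * _)).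
  rewrite big_ltn// /s' eqxx mulrC; congr (_ * _).
  by apply: eq_big_nat => k /andP[mk _]; rewrite gtn_eqF.
have := exponential_moment (q_gt0 mn) mU (mS m) U0 US Utail (c_lt mn).
move=> H; transitivity (\int[P]_w (U w * expR (c m * S m w))%:E)%E.
  apply: eq_integral => w _; congr _%:E; rewrite /W /U mulrAC; congr (_ * _).
  by rewrite big_ord_recr /= expRD.
by rewrite H /K' big_ord_recr /=; congr _%:E; ring.
Qed.

Lemma exponential_product_moment :
  (\int[P]_(w in D) (expR (\sum_(k < n) c k * S k w))%:E
   = (K * \prod_(k < n) (q k / (q k - c k)))%:E)%E.
Proof.
have := @partial_moment n (fun=> 0) (leqnn n) (fun=> lexx 0).
rewrite big_geq// mulr1 => <-; rewrite integral_mkcond.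
apply: eq_integral => w _; rewrite patchE /W indicE.
have -> : tail n (fun=> 0) = D.
  apply/seteqP; split => [z []//|z Dz]; split => // k /andP[nk].
  by rewrite ltnNge nk.
by case: ifPn; rewrite ?mulr1 ?mulr0.
Qed.

End exponential_product_moment.

(** * Right-continuous paths *)

Lemma measure_finType d (T : measurableType d) (R : realType)
  (mu : {measure set T -> \bar R}) (H : finType) (F : H -> set T) :
  (forall h, measurable (F h)) -> trivIset setT F ->
  mu (\bigcup_h F h) = (\sum_(h : H) mu (F h))%E.
Proof.
move=> mF tF; rewrite measure_fin_bigcup//; last exact: finite_finset.
have -> : [set: H] = [set` index_enum H].
  by apply/seteqP; split => // h _; rewrite /= mem_index_enum.
by rewrite -fsbig_seq// index_enum_uniq.
Qed.


Lemma measure_le_sum d (T : measurableType d) (R : realType)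
  (mu : {measure set T -> \bar R}) (I : eqType) (s : seq I) (F : I -> set T) (E : set T) :
  measurable E -> (forall k, measurable (F k)) ->
  (forall w, E w -> exists2 k, k \in s & F k w) ->
  (mu E <= \sum_(k <- s) mu (F k))%E.
Proof.
move=> + mF; elim: s E => [|k s IH] E mE HE.
  rewrite big_nil (_ : E = set0) ?measure0//.
  by apply/seteqP; split => // w /HE[].
rewrite big_cons; apply: (@le_trans _ _ (mu (F k `|` (E `\` F k)))).
  apply: le_measure; rewrite ?inE//.
    by apply: measurableU => //; exact: measurableD.
  by move=> w Ew; have [h|h] := pselect (F k w); [left|right].
apply: (@le_trans _ _ (mu (F k) + mu (E `\` F k))%E).
  by apply: measureU2 => //; exact: measurableD.
rewrite leeD2l//; apply: IH => [|w [/HE[l]]]; first exact: measurableD.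
by rewrite inE => /predU1P[->//|ls Fl _]; exists l.
Qed.

Section Path.
Context {R : realType} {V : finType}.
Variable x : R -> V.
Hypothesis rcont : forall t, 0 <= t -> \forall s \near t^'+, x s = x t.

Lemma right_const t : 0 <= t ->
  exists2 e : R, 0 < e & forall s, t <= s < t + e -> x s = x t.
Proof.
move=> /rcont [e /= e0 H]; exists e => // s /andP[].
rewrite le_eqVlt => /predU1P[<-//|ts] se; apply: H => //=.
by rewrite ltr0_norm ?subr_lt0// opprB ltrBlDl.
Qed.

Lemma jump_timeS n : jump_time x n.+1 = ereal_inf [set t%:E | t in
  [set t | (jump_time x n < t%:E)%E /\ x t <> jump_chain x n]].
Proof. by []. Qed.

Lemma jump_time_le n : (jump_time x n <= jump_time x n.+1)%E.
Proof. by rewrite jump_timeS; apply: le_ereal_inf_tmp => _ [t [/ltW + _] <-]. Qed.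

Lemma jump_time_ge0 n : (0 <= jump_time x n)%E.
Proof. by elim: n => // n /le_trans; apply; exact: jump_time_le. Qed.

Lemma jump_time_mono m n : (m <= n)%N -> (jump_time x m <= jump_time x n)%E.
Proof.
move=> /subnK <-; elim: (n - m)%N => // k /le_trans; apply.
by rewrite addSn; exact: jump_time_le.
Qed.

Lemma jump_time_fin n : (jump_time x n < +oo)%E -> jump_time x n \is a fin_num.
Proof. by move=> h; rewrite ge0_fin_numE// jump_time_ge0. Qed.

Lemma jump_time_lt n : (jump_time x n < +oo)%E ->
  (jump_time x n < jump_time x n.+1)%E.
Proof.
move=> /jump_time_fin fT; have := jump_time_ge0 n.
rewrite -[jump_time x n]fineK// lee_fin => /right_const[e e0 H].
apply: (@lt_le_trans _ _ (fine (jump_time x n) + e)%:E).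
  by rewrite lte_fin ltrDl.
rewrite jump_timeS; apply: le_ereal_inf_tmp => _ [t /= [tT xt] <-]; rewrite lee_fin leNgt.
apply/negP => te; apply: xt; apply: H; rewrite te andbT.
by move: tT; rewrite -[jump_time x n]fineK// lte_fin => /ltW.
Qed.

Lemma jump_chain_const n t : (jump_time x n <= t%:E)%E ->
  (t%:E < jump_time x n.+1)%E -> x t = jump_chain x n.
Proof.
move=> Tt tT; have fT : jump_time x n \is a fin_num.
  by apply: jump_time_fin; exact: le_lt_trans (ltry t).
have [//|/eqP xt] := eqVneq (x t) (jump_chain x n).
move: Tt; rewrite le_eqVlt => /predU1P[Tt|Tt].
  by rewrite /jump_chain Tt.
suff : (jump_time x n.+1 <= t%:E)%E by rewrite leNgt tT.
by rewrite jump_timeS; apply: ereal_inf_lbound; exists t.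
Qed.

(** For measurability: the infimum defining a jump time runs over uncountably many times, but by
    right continuity a value that differs persists on an interval, which contains a rational. *)
Lemma jump_time_lt_rat n c : (jump_time x n.+1 < c%:E)%E <->
  exists r : rat, [/\ (jump_time x n < (ratr r)%:E)%E, ratr r < c
    & x (ratr r) <> jump_chain x n].
Proof.
rewrite jump_timeS; split=> [/ereal_inf_lt[_ [t [Tt xt] <-]]|[r [Tr rc xr]]]; last first.
  apply: (@le_lt_trans _ _ (ratr r)%:E); last by rewrite lte_fin.
  by apply: ereal_inf_lbound; exists (ratr r).
rewrite lte_fin => tc.
have t0 : 0 <= t.
  by rewrite -lee_fin (le_trans (jump_time_ge0 n))// ltW.
have [e e0 H] := right_const t0.
have [r] : exists q : rat, ratr q \in `]t, (Num.min c (t + e))[.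
  by apply: rat_in_itvoo; rewrite lt_min tc ltrDl.
rewrite in_itv/= lt_min => /and3P[tr rc re]; exists r; split => //.
  by rewrite (lt_trans Tt)// lte_fin.
by rewrite H// re ltW.
Qed.

Lemma eq_path_rat t i : 0 <= t -> (x t = i <->
  exists n : nat, forall r : rat, t < ratr r < t + n.+1%:R^-1 -> x (ratr r) = i).
Proof.
move=> t0; have [e e0 H] := right_const t0; split=> [<-|[n Hn]].
  exists (Num.truncn e^-1) => r /andP[tr re]; apply: H; rewrite ltW//=.
  apply: (lt_le_trans re); rewrite lerD2l invf_ple ?posrE// ltW//.
  by rewrite truncnS_gt// invr_ge0 ltW.
have [r] : exists q : rat, ratr q \in `]t, (t + Num.min n.+1%:R^-1 e)[.
  by apply: rat_in_itvoo; rewrite ltrDl lt_min invr_gt0 ltr0n.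
rewrite in_itv/= => /andP[tr re]; rewrite -(Hn r).
  by rewrite H// ltW//= (lt_le_trans re)// lerD2l ge_min lexx orbT.
by rewrite tr (lt_le_trans re)// lerD2l ge_min lexx.
Qed.

(** Restricted to [0 <= s] because nothing is assumed about the path at negative times. *)
Let Z i : set R := [set s | 0 <= s /\ x s = i].
Hypothesis mZ : forall i, measurable (Z i).

Local Notation mu := (@lebesgue_measure R).

Let mZI i (J : interval R) : measurable (Z i `&` [set` J]).
Proof. by apply: measurableI; [exact: mZ|]. Qed.

Let muZI_le i (J : interval R) : (mu (Z i `&` [set` J]) <= mu [set` J])%E.
Proof. by apply: le_measure; rewrite ?inE//; exact: mZI. Qed.

Let muZI_fin i a b s t :
  mu (Z i `&` [set` Interval (BSide a s) (BSide b t)]) \is a fin_num.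
Proof.
rewrite ge0_fin_numE//; apply: le_lt_trans (muZI_le _ _) _.
by rewrite lebesgue_measure_itv; case: ifP; rewrite ?ltry// -EFinB ltry.
Qed.

Lemma local_timeE t i :
  local_time x t i = fine (mu (Z i `&` `[0, t])).
Proof.
rewrite /local_time /Rintegral; congr fine.
rewrite -integral_indic//; last exact: mZ.
apply: eq_integral => s.
rewrite inE/= in_itv/= => /andP[s0 st]; rewrite indicE.
congr (_%:R%:E); congr nat_of_bool.
by apply/eqP/idP => [<-|]; rewrite inE /Z/=; [split|case].
Qed.

Lemma local_time_ge0 t i : 0 <= local_time x t i.
Proof. by rewrite local_timeE fine_ge0. Qed.

Lemma sum_local_time t : 0 <= t -> \sum_i local_time x t i = t.
Proof.
move=> t0; apply: EFin_inj; rewrite -sumEFin.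
transitivity (\sum_i mu (Z i `&` `[0%R, t]))%E.
  by apply: eq_bigr => i _; rewrite local_timeE fineK// muZI_fin.
rewrite -measure_finType.
- rewrite -setI_bigcupl (_ : _ `&` _ = `[0, t]%classic).
    rewrite -[LHS]/(mu `[0, t]) lebesgue_measure_itv/= lte_fin; case: ltgtP t0 => // [t0 _|<-//].
    by rewrite sube0.
  apply/seteqP; split => [s []//|s] /= st; split => //.
  by exists (x s) => //; split => //; move: st; rewrite in_itv/= => /andP[].
- by move=> i; exact: mZI.
- by move=> i j _ _ [s [[[_ <-] _] [[_ <-] _]]].
Qed.

Lemma local_timeB s t i : 0 <= s -> s <= t ->
  local_time x t i = local_time x s i + fine (mu (Z i `&` `]s, t])).
Proof.
move=> s0 st; rewrite !local_timeE -fineD ?muZI_fin//.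
rewrite -measureU; [|exact: mZI|exact: mZI|]; last first.
  apply/seteqP; split => // r [[_ +] [_ +]]; rewrite /= !in_itv/=.
  by move=> /andP[_ rs] /andP[sr _]; rewrite ltNge rs in sr.
rewrite -setIUr; congr (fine (mu (_ `&` _))).
apply/seteqP; split => r /=; rewrite !in_itv/=.
  by move=> /andP[-> rt]; case: (leP r s) => rs; [left|right; rewrite rt].
by move=> [/andP[-> /le_trans]|/andP[sr ->]]; [apply|rewrite (le_trans s0)// ltW].
Qed.

Lemma local_time_lipschitz s t i : 0 <= s -> s <= t ->
  `|local_time x t i - local_time x s i| <= t - s.
Proof.
move=> s0 st; rewrite (local_timeB _ s0 st) addrAC subrr add0r ger0_norm ?fine_ge0//.
have [<-|st'] := eqVneq s t.
  by rewrite set_itvoc0 setI0 measure0 subrr.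
rewrite -lee_fin fineK ?muZI_fin//; apply: le_trans (muZI_le _ _) _.
by rewrite lebesgue_measure_itv/= lte_fin lt_neqAle st' st.
Qed.

Let holding k := fine (jump_time x k.+1) - fine (jump_time x k).

Let occupation_const s t i j : 0 <= s -> s <= t ->
  (forall r, s < r < t -> x r = j) ->
  fine (mu (Z i `&` `]s, t])) = (t - s) * (j == i)%:R.
Proof.
move=> s0 st H; have [eji|nji] := eqVneq j i; last first.
  rewrite mulr0 (_ : fine _ = 0)//.
  have : (mu (Z i `&` `]s, t]) <= mu [set` `[t, t]])%E.
    apply: le_measure; rewrite ?inE//; first exact: mZI.
    move=> r [[_ xr]] /=; rewrite !in_itv/= => /andP[sr rt]; rewrite rt andbT.
    rewrite leNgt; apply/negP => {}rt.
    by move: nji; rewrite -xr (H r) ?sr// eqxx.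
  by rewrite lebesgue_measure_itv/= ltxx measure_le0 => /eqP ->.
rewrite mulr1; have [<-|st'] := eqVneq s t.
  by rewrite set_itvoc0 setI0 measure0 subrr.
have st2 : s < t by rewrite lt_neqAle st'.
suff -> : mu (Z i `&` `]s, t]) = (t - s)%:E by [].
apply/eqP; rewrite eq_le; apply/andP; split.
  apply: le_trans (muZI_le _ _) _.
  by rewrite lebesgue_measure_itv/= lte_fin st2.
apply: (@le_trans _ _ (mu `]s, t[)).
  by rewrite lebesgue_measure_itv/= lte_fin st2.
apply: le_measure; rewrite ?inE//; first exact: mZI.
move=> r /=; rewrite !in_itv/= => /andP[sr rt]; split; last by rewrite sr ltW.
by split; [rewrite (le_trans s0)// ltW|rewrite H ?sr].
Qed.

Let local_time_stretch n t i : (jump_time x n <= t%:E)%E ->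
  (t%:E <= jump_time x n.+1)%E ->
  local_time x t i = local_time x (fine (jump_time x n)) i
    + (t - fine (jump_time x n)) * (jump_chain x n == i)%:R.
Proof.
move=> Tt tT; have fT : jump_time x n \is a fin_num.
  by apply: jump_time_fin; exact: le_lt_trans (ltry t).
have T0 : 0 <= fine (jump_time x n) by rewrite fine_ge0 ?jump_time_ge0.
have Tt' : fine (jump_time x n) <= t by rewrite -lee_fin fineK.
rewrite (local_timeB _ T0 Tt') (@occupation_const _ _ _ (jump_chain x n))//.
move=> r /andP[Tr rt]; apply: jump_chain_const.
  by rewrite -[jump_time x n]fineK// lee_fin ltW.
by apply: lt_le_trans tT; rewrite lte_fin.
Qed.

(** Both inequalities on [t] are weak, so that the formula also applies at the jump times
    themselves. This lets the stretches be chained by induction, and later gives the local times at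
    [tau n]. *)
Lemma local_time_holding n t i : (jump_time x n <= t%:E)%E ->
  (t%:E <= jump_time x n.+1)%E ->
  local_time x t i = \sum_(k < n) holding k * (jump_chain x k == i)%:R
    + (t - fine (jump_time x n)) * (jump_chain x n == i)%:R.
Proof.
move=> Tt tT; rewrite (local_time_stretch _ Tt tT); congr (_ + _).
have : (jump_time x n < +oo)%E by exact: le_lt_trans (ltry t).
elim: n {t Tt tT} => [_|n IH Tn].
  rewrite big_ord0 /=; apply/eqP; rewrite eq_le local_time_ge0 andbT.
  rewrite local_timeE -lee_fin fineK ?muZI_fin//; apply: le_trans (muZI_le _ _) _.
  by rewrite lebesgue_measure_itv/= ltxx.
have Tn' := le_lt_trans (jump_time_le n) Tn.
rewrite big_ord_recr/= -IH//; apply: local_time_stretch;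
  by rewrite fineK ?jump_time_fin// jump_time_le.
Qed.

End Path.

(** * Measurability *)

Section Measurability.
Context {R : realType} {V : finType} d (Omega : measurableType d).
Variable X : R -> Omega -> V.
Hypothesis mX : forall t i, 0 <= t -> measurable [set w | X t w = i].
Hypothesis rcont : forall w t, 0 <= t -> \forall s \near t^'+, X s w = X t w.

(** By [eq_path_rat], [X t w = i] means that for some [n] no rational in []t, t + 1/(n+1)[] shows
    another value. For fixed [n] and rational the excluded set is a rectangle, and a rational above
    [t >= 0] is positive, where [mX] applies. *)
Lemma measurable_joint i :
  measurable [set z : R * Omega | 0 <= z.1 /\ X z.1 z.2 = i].
Proof.
have -> : [set z : R * Omega | 0 <= z.1 /\ X z.1 z.2 = i] =
  ([set s : R | 0 <= s] `*` setT) `&` \bigcup_(n : nat) ~` \bigcup_(r : rat)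
     ([set s : R | s < ratr r < s + n.+1%:R^-1] `*`
        [set w | (0 : R) < ratr r /\ X (ratr r) w <> i]
      `&` ([set s : R | 0 <= s] `*` setT)).
  apply/seteqP; split=> [[t w]/= [t0 /(eq_path_rat (rcont w) _ t0)[n Hn]]|[t w]/= []].
    split => //; exists n => // -[r _ [/= [rr [r0 Xr]] _]].
    exact/Xr/Hn.
  move=> [t0 _] [n _ Hn]; split => //.
  apply/(eq_path_rat (rcont w) _ t0); exists n => r /andP[tr re].
  apply: contra_notP Hn => Xr; exists r => //=; split => //.
  by rewrite tr re; split => //; split => //; exact: le_lt_trans tr.
have mpos : measurable [set s : R | 0 <= s].
  rewrite (_ : mkset _ = `[0, +oo[%classic)//.
  by apply/seteqP; split => s /=; rewrite in_itv/= andbT.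
apply: measurableI; first exact: measurableX.
apply: bigcup_measurable => n _; apply: measurableC.
apply: bigcupT_measurable_rat => r; apply: measurableI; last exact: measurableX.
apply: measurableX.
  rewrite (_ : mkset _ = `](ratr r - n.+1%:R^-1), (ratr r)[%classic)//.
  by apply/seteqP; split => s /=; rewrite in_itv/= ltrBlDr andbC.
have [r0|r0] := ltP 0 (ratr r : R); last first.
  by rewrite (_ : mkset _ = set0)//; apply/seteqP; split => // w [].
rewrite (_ : mkset _ = ~` [set w | X (ratr r) w = i]); last first.
  by apply/seteqP; split => w //= -[].
by apply: measurableC; apply: mX; exact: ltW.
Qed.

Lemma measurable_occupation w i : measurable [set s | 0 <= s /\ X s w = i].
Proof.
rewrite (_ : mkset _ =
    ysection [set z : R * Omega | 0 <= z.1 /\ X z.1 z.2 = i] w).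
  by apply: measurable_ysection; exact: measurable_joint.
by apply/seteqP; split => s; rewrite /ysection/= inE.
Qed.

Lemma measurable_local_time t i :
  measurable_fun setT (fun w => local_time (X^~ w) t i).
Proof.
have mI : measurable ([set z : R * Omega | 0 <= z.1 /\ X z.1 z.2 = i] `&`
    ([set s : R | 0 <= s <= t] `*` setT)).
  apply: measurableI; [exact: measurable_joint|apply: measurableX => //].
  rewrite (_ : mkset _ = `[0, t]%classic); first exact: measurable_itv.
  by apply/seteqP; split => s /=; rewrite in_itv/=.
have := @measurable_fun_ysection _ _ _ _ _ (@lebesgue_measure R) _ mI.
move=> /(measurableT_comp (@fine_measurable R setT measurableT)) H.
apply: eq_measurable_fun H => w _ /=.
rewrite local_timeE; last exact: measurable_occupation.
congr (fine (_ _)); apply/seteqP; split => s; rewrite /ysection/= inE/=.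
  by move=> [? []].
by move=> [? ?].
Qed.

(** The two claims feed each other: [jump_chain n] is [X] at the random time [jump_time n], which
    calls for joint measurability, and the rational description of [jump_time n.+1] involves
    [jump_chain n]. *)
Let mT_mY n : measurable_fun setT (fun w => jump_time (X^~ w) n) /\
  forall i, measurable [set w | jump_chain (X^~ w) n = i].
Proof.
have mY m : measurable_fun setT (fun w => jump_time (X^~ w) m) ->
    forall i, measurable [set w | jump_chain (X^~ w) m = i].
  move=> mT i; have mf : measurable_fun setT
      (fun w => (fine (jump_time (X^~ w) m), w) : R * Omega).
    apply: measurable_fun_pair => //.
    exact: (measurableT_comp (@fine_measurable R setT measurableT)).
  have := mf measurableT _ (measurable_joint i); rewrite setTI.
  congr (measurable _); apply/seteqP; split => w /=; first by case.
  by split => //; rewrite fine_ge0// jump_time_ge0.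
elim: n => [|n [mT mYn]]; first by split; [|apply: mY]; exact: measurable_cst.
suff mT' : measurable_fun setT (fun w => jump_time (X^~ w) n.+1).
  by split => //; exact: mY.
apply: (measurability _ (ErealGenInftyO.measurableE R)) => // _ [_ [c ->] <-].
rewrite setTI (_ : _ @^-1` _ = \bigcup_(r : rat)
    ([set w | (jump_time (X^~ w) n < (ratr r)%:E)%E] `&`
     ([set w | (0 : R) < ratr r < c] `&` \bigcup_(i : V)
       ([set w | jump_chain (X^~ w) n = i] `\` [set w | X (ratr r) w = i]))));
  last first.
  apply/seteqP; split => w /=; rewrite in_itv/=.
    move=> /(jump_time_lt_rat (rcont w))[r [Tr rc Xr]]; exists r => //=.
    split => //; split; last by exists (jump_chain (X^~ w) n).
    by rewrite rc andbT -lte_fin; exact: le_lt_trans (jump_time_ge0 _ _) Tr.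
  move=> [r _ [/= Tr [/andP[_ rc] [i _ [/= <- Xr]]]]].
  by apply/(jump_time_lt_rat (rcont w)); exists r.
apply: bigcupT_measurable_rat => r; apply: measurableI.
  rewrite -[X in measurable X]setTI.
  exact: emeasurable_fun_infty_o.
have [/andP[r0 rc]|rc] := boolP (0 < (ratr r : R) < c); last first.
  by rewrite (_ : mkset _ = set0) ?set0I//; apply/seteqP; split => // w; rewrite (negbTE rc).
apply: measurableI; first by rewrite (_ : mkset _ = setT)//; apply/seteqP; split.
apply: fin_bigcup_measurable => // i _.
by apply: measurableD => //; apply: mX; exact: ltW.
Qed.

Lemma measurable_jump_time n : measurable_fun setT (fun w => jump_time (X^~ w) n).
Proof. by case: (mT_mY n). Qed.

Lemma measurable_jump_chain n i : measurable [set w | jump_chain (X^~ w) n = i].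
Proof. by case: (mT_mY n). Qed.

End Measurability.

(** The sets containing a box around [p] form a filter that converges to [p] in each coordinate,
    hence in the topology of pointwise convergence; so every neighbourhood of [p] belongs to this
    filter. *)
Lemma nbhs_ptws_box (R : realType) (V : finType) (p : {ptws V -> R})
  (U : set {ptws V -> R}) :
  nbhs p U -> exists2 e : R, 0 < e &
    forall g : V -> R, (forall i, `|p i - g i| < e) -> U g.
Proof.
move=> pU.
pose F : set_system {ptws V -> R} := [set U | exists2 e : R, 0 < e &
  forall g : V -> R, (forall i, `|p i - g i| < e) -> U g].
have FF : Filter F.
  split; first by exists 1.
  - move=> A B [e e0 Ae] [f f0 Bf]; exists (Num.min e f); first by rewrite lt_min e0.
    by move=> g gi; split; [apply: Ae|apply: Bf] => i; have := gi i; rewrite lt_min => /andP[].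
  - by move=> A B AB [e e0 Ae]; exists e => // g /Ae /AB.
suff : {ptws, F --> p} by apply.
apply/(@pointwise_cvgP (discrete_topology V) R F p FF) => i; apply/cvgrPdist_lt => e e0.
by exists e => // g; apply.
Qed.

(** The sets with measurable preimage form a sigma-algebra, so open sets suffice. An open set is the
    union of the boxes with rational centre and radius [1/(n+1)] that it contains, and these are
    countably many because [V] is finite. *)
Lemma measurable_preimage_ptws d (T : measurableType d) (R : realType)
  (V : finType) (f : T -> {ptws V -> R}) (A : set {ptws V -> R}) :
  (forall i, measurable_fun setT (fun w => f w i)) ->
  <<s @open {ptws V -> R} >> A -> measurable (f @^-1` A).
Proof.
move=> mf sA; apply: (sA [set B | measurable (f @^-1` B)]); split.
  split; first by rewrite /= preimage_set0.
  - by move=> B mB; rewrite /= setTD preimage_setC; exact: measurableC.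
  - by move=> B mB; rewrite /= preimage_bigcup; apply: bigcup_measurable => k _; exact: mB.
move=> U oU /=.
pose box (c : {ffun V -> rat} * nat) : set {ptws V -> R} :=
  [set g | forall i, `|ratr (c.1 i) - g i| < c.2.+1%:R^-1].
pose F c := [set w | box c `<=` U /\ box c (f w)].
have -> : f @^-1` U = \bigcup_c F c.
  apply/seteqP; split => [w /= Uw|w [c _ [cU cw]]]; last exact: cU.
  have [e e0 He] : exists2 e : R, 0 < e &
      forall g : V -> R, (forall i, `|f w i - g i| < e) -> U g.
    by apply: nbhs_ptws_box; exact: open_nbhs_nbhs.
  pose n := Num.truncn (e / 2)^-1.
  have ne : n.+1%:R^-1 < e / 2.
    rewrite invf_plt ?posrE ?divr_gt0//; exact: truncnS_gt.
  have /choice[q Hq] : forall i, exists q : rat,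
      ratr q \in `](f w i), (f w i + n.+1%:R^-1)[.
    by move=> i; apply: rat_in_itvoo; rewrite ltrDl.
  have qw i : `|ratr (q i) - f w i| < n.+1%:R^-1.
    have := Hq i; rewrite in_itv/= => /andP[h1 h2].
    by rewrite gtr0_norm ?subr_gt0// ltrBlDl.
  exists ([ffun i => q i], n) => //; split; last by move=> i /=; rewrite ffunE.
  move=> g /= Hg; apply: He => i; have := Hg i; rewrite ffunE => gi.
  rewrite -(subrKA (ratr (q i))) (splitr e) (le_lt_trans (ler_normD _ _))//.
  by rewrite ltrD// ?(lt_trans _ ne)// distrC.
apply: countable_bigcupT_measurable => [|c].
  exact: (@countableP ({ffun V -> rat} * nat)%type).
rewrite (_ : F c = [set w | box c `<=` U] `&` \bigcap_(i in [set: V])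
   [set w | `|ratr (c.1 i) - f w i| < c.2.+1%:R^-1]); last first.
  apply/seteqP; split => w [h1 h2]; split => // i; first by move=> _; exact: h2.
  exact: (h2 i I).
apply: measurableI; first by case: (pselect (box c `<=` U)) => h;
  [rewrite (_ : mkset _ = setT)|rewrite (_ : mkset _ = set0)] => //;
  apply/seteqP; split.
apply: fin_bigcap_measurable => // i _.
have mg : measurable_fun setT (fun w => `|ratr (c.1 i) - f w i|).
  by apply: measurableT_comp => //; exact: measurable_funB.
rewrite -[X in measurable X]setTI.
have : measurable_fun setT (fun w => `|ratr (c.1 i) - f w i| < c.2.+1%:R^-1).
  exact: measurable_fun_ltr.
by move=> /(_ measurableT [set true]); exact.
Qed.

(** * Weighted sums over histories *)

Lemma big_tuple_cons (R : Type) (idx : R) (op : Monoid.com_law idx)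
  (V : finType) n (F : n.+1.-tuple V -> R) :
  \big[op/idx]_t F t = \big[op/idx]_j \big[op/idx]_(t : n.-tuple V) F (cons_tuple j t).
Proof.
rewrite pair_big /= (reindex (fun p : V * n.-tuple V => cons_tuple p.1 p.2))//=.
exists (fun t => (thead t, behead_tuple t)) => [[j t] _|t _] /=.
  by congr pair; apply: val_inj.
by rewrite [RHS]tuple_eta; apply: val_inj.
Qed.

Section PathSum.
Context {R : realFieldType} {V : finType}.
Variable e : rel V.
Implicit Types (G : nat -> V -> R) (f u : V -> R).

Definition nbr_sum u i : R := \sum_j (e i j)%:R * u j.

(** A Feynman-Kac sum over walks of [n] steps. The weight [G] may change with the step, since in the
    upper bound the last holding time is weighted differently from the others. *)
Fixpoint path_sum n G f i : R :=
  if n is m.+1 then G 0%N i * nbr_sum (path_sum m (fun k => G k.+1) f) i else f i.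

(** A total function of [k], as [dORRW_law] requires; beyond [n] it takes the default value [o]. *)
Definition history o n (h : n.-tuple V) k : V := nth o (o :: h) k.

Lemma history0 o n (h : n.-tuple V) : history o h 0 = o. Proof. by []. Qed.

Lemma sum_history n G f o :
  \sum_(h : n.-tuple V)
    (\prod_(k < n) ((e (history o h k) (history o h k.+1))%:R * G k (history o h k)))
    * f (history o h n) = path_sum n G f o.
Proof.
elim: n G o => [|n IH] G o.
  by rewrite (big_pred1 [tuple]) ?big_ord0 ?mul1r// => t; rewrite [t]tuple0 /= eqxx.
rewrite big_tuple_cons /= /nbr_sum mulr_sumr; apply: eq_bigr => j _.
rewrite -IH mulr_sumr mulr_sumr; apply: eq_bigr => h _.
(* The two sides use the default values [o] and [j], hence the bound on [k]. *)
have hE k : (k <= n)%N -> history o (cons_tuple j h) k.+1 = history j h k.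
  by move=> kn; apply: set_nth_default; rewrite /= size_tuple.
rewrite hE// big_ord_recl /= hE// history0 -!mulrA [RHS]mulrCA; congr (_ * (_ * (_ * _))).
by apply: eq_bigr => k _; rewrite /bump /= add1n !hE// ltnW.
Qed.

Lemma ler_nbr_sum f u i : (forall j, f j <= u j) -> nbr_sum f i <= nbr_sum u i.
Proof. by move=> fu; apply: ler_sum => j _; rewrite ler_wpM2l. Qed.

Lemma nbr_sumZ (c : R) u i : nbr_sum (fun j => c * u j) i = c * nbr_sum u i.
Proof. by rewrite mulr_sumr; apply: eq_bigr => j _; rewrite mulrCA. Qed.

(** Comparison principle: each operator [G k * nbr_sum] is monotone, so a function [u] that it
    multiplies by at most [r k] can be pulled through all the steps. *)
Lemma path_sum_le n G f u (C : R) (r : nat -> R) i :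
  (forall k j, 0 <= G k j) -> (forall k, (k < n)%N -> 0 <= r k) ->
  (forall j, f j <= C * u j) ->
  (forall k j, (k < n)%N -> G k j * nbr_sum u j <= r k * u j) -> 0 <= C ->
  path_sum n G f i <= C * (\prod_(k < n) r k) * u i.
Proof.
move=> G0 r0 fu + C0; elim: n G r G0 r0 i => [|n IH] G r G0 r0 i Gu.
  by rewrite big_ord0 mulr1.
rewrite /= big_ord_recl.
apply: (@le_trans _ _ (G 0%N i * nbr_sum (fun j => C * (\prod_(k < n) r k.+1) * u j) i)).
  rewrite ler_wpM2l//; apply: ler_nbr_sum => j.
  by apply: (IH _ (fun k => r k.+1)) => k;
    [exact: G0|exact: (r0 k.+1)|move=> l; exact: (Gu k.+1)].
rewrite (nbr_sumZ (C * _)) mulrCA (mulrC (r _)) [X in _ <= X * _]mulrA -[leRHS]mulrA.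
rewrite ler_wpM2l ?Gu// mulr_ge0// prodr_ge0// => k _.
exact: (r0 _ (ltn_ord (lift ord0 k))).
Qed.

Lemma path_sum_ge n G f u (c : R) i : (forall k j, 0 <= G k j) ->
  (forall j, c * u j <= f j) ->
  (forall k j, (k < n)%N -> u j <= G k j * nbr_sum u j) -> 0 <= c ->
  c * u i <= path_sum n G f i.
Proof.
move=> G0 fu + c0; elim: n G G0 i => [//|n IH] G G0 i Gu /=.
apply: (@le_trans _ _ (G 0%N i * nbr_sum (fun j => c * u j) i)).
  by rewrite nbr_sumZ mulrCA ler_wpM2l// Gu.
rewrite ler_wpM2l//; apply: ler_nbr_sum => j; apply: IH => k l; [exact: G0|exact: (Gu k.+1)].
Qed.

End PathSum.

(** * Comparison of the reinforced rates with those of the simple random walk *)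

Section Rates.
Context {R : realType} {V : finType}.
Variables (e : rel V) (a : R).
Hypotheses (a_gt0 : 0 < a) (a_le1 : a <= 1).

Lemma degreeE i : (degree e i)%:R = \sum_j (e i j)%:R :> R.
Proof.
rewrite /degree -sum1_card natr_sum big_mkcond /=; apply: eq_bigr => j _.
by rewrite inE; case: (e i j).
Qed.

Lemma jump_rate_le y n j : jump_rate e a y n j <= (e (y n) j)%:R.
Proof. by rewrite /jump_rate; case: ifP => // /negbFE ->; case: ifP. Qed.

Lemma jump_rate_ge y n j : a * (e (y n) j)%:R <= jump_rate e a y n j.
Proof.
rewrite /jump_rate; case: ifPn => [/negbTE ->|/negbNE ->]; first by rewrite mulr0.
by rewrite mulr1; case: ifP.
Qed.

Lemma jump_rate_ge0 y n j : 0 <= jump_rate e a y n j.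
Proof. by apply: le_trans (jump_rate_ge _ _ _); rewrite mulr_ge0 ?(ltW a_gt0). Qed.

Lemma exit_rate_le y n : exit_rate e a y n <= (degree e (y n))%:R.
Proof. by rewrite degreeE; apply: ler_sum => j _; exact: jump_rate_le. Qed.

Lemma exit_rate_ge y n : a * (degree e (y n))%:R <= exit_rate e a y n.
Proof.
by rewrite degreeE mulr_sumr; apply: ler_sum => j _; exact: jump_rate_ge.
Qed.

End Rates.


(** * The Dirichlet form *)

Section Dirichlet.
Context {R : realType} {V : finType}.
Variables (e : rel V).
Hypotheses (e_sym : symmetric e) (e_irr : irreflexive e).

(** The finite branch of [Dir], kept without the positivity test so that it is real-valued at every
    point of the simplex. *)
Definition dir_form (x : V -> R) : R :=
  \sum_(p : V * V | e p.1 p.2 && (enum_rank p.1 < enum_rank p.2)%N)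
        (Num.sqrt (x p.1) - Num.sqrt (x p.2)) ^+ 2.

Lemma sum_edges (g : V -> V -> R) :
  \sum_i \sum_j (e i j)%:R * g i j =
  \sum_(p : V * V | e p.1 p.2 && (enum_rank p.1 < enum_rank p.2)%N)
    (g p.1 p.2 + g p.2 p.1).
Proof.
rewrite pair_big /=.
under eq_bigr do rewrite mulr_natl mulrb.
rewrite -big_mkcond /= (bigID (fun p : V * V => (enum_rank p.1 < enum_rank p.2)%N)) /=.
rewrite big_split /=; congr (_ + _).
rewrite (reindex (fun p : V * V => (p.2, p.1)))/=; last first.
  by exists (fun p => (p.2, p.1)) => -[].
apply: eq_bigl => -[i j] /=; rewrite e_sym; case: (boolP (e i j)) => //= eij.
rewrite -leqNgt leq_eqVlt; case: eqP => //= /val_inj/enum_rank_inj ij.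
by rewrite ij e_irr in eij.
Qed.

Lemma dir_formE (x : V -> R) : (forall i, 0 <= x i) ->
  dir_form x = \sum_i ((degree e i)%:R * x i)
    - \sum_i Num.sqrt (x i) * nbr_sum e (fun j => Num.sqrt (x j)) i.
Proof.
move=> x0; under eq_bigr do rewrite degreeE mulr_suml.
under [X in _ - X]eq_bigr => i _.
  rewrite /nbr_sum mulr_sumr; under eq_bigr do rewrite mulrCA; over.
rewrite !sum_edges -sumrB; apply: eq_bigr => p _.
rewrite sqrrB !sqr_sqrtr//; ring.
Qed.

Lemma simplex_le1 (x : V -> R) i : simplex x -> x i <= 1.
Proof.
by move=> [x0 <-]; rewrite (bigD1 i)//= lerDl sumr_ge0.
Qed.

(* The square roots of the points of a grid of mesh [eta ^+ 2], shifted away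
   from the boundary: finitely many test functions serve all points [x]. *)
Lemma dir_form_grid (eps : R) : 0 < eps ->
  exists (N : nat) (u : {ffun V -> 'I_N.+1} -> V -> R), (forall k i, 0 < u k i) /\
  forall x, simplex x -> exists k,
    dir_form x - eps <= \sum_i ((degree e i)%:R - nbr_sum e (u k) i / u k i) * x i.
Proof.
(* The product of [sqrt x_i + eta] and [sqrt x_j + eta] exceeds that of the two roots by at most
   [2 eta + eta ^+ 2 <= 3 eta], once for each oriented edge. *)
move=> eps0; pose M : R := 3 * \sum_i (degree e i)%:R.
have M0 : 0 <= M by rewrite mulr_ge0// sumr_ge0.
pose eta : R := Num.min 1 (eps / (M + 1)).
have eta0 : 0 < eta by rewrite lt_min ltr01 divr_gt0// ltr_wpDl.
have eta1 : eta <= 1 by rewrite ge_min lexx.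
have etaM : M * eta <= eps.
  apply: (@le_trans _ _ ((M + 1) * eta)); first by rewrite ler_wpM2r ?(ltW eta0)// lerDl.
  by rewrite mulrC -ler_pdivlMr ?ltr_wpDl// ge_min lexx orbT.
pose N := Num.truncn (eta ^- 2).
(* The square of [u k i] is the grid point [eta ^+ 2 * (k i + 1)]. For the [k] chosen below it lies
   just above [x i]; the successor also keeps [u] positive where [x] vanishes. *)
pose u (k : {ffun V -> 'I_N.+1}) i : R := eta * Num.sqrt (k i).+1%:R.
exists N, u; split=> [k i|x xS]; first by rewrite mulr_gt0// sqrtr_gt0 ltr0n.
have [x0 x1] := xS; have xle i := simplex_le1 i xS.
exists [ffun i => inord (Num.truncn (x i / eta ^+ 2))]; set k := finfun _.
have ke i : k i = Num.truncn (x i / eta ^+ 2) :> nat.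
  rewrite ffunE inordK// ltnS le_truncn// ler_pdivrMr ?exprn_gt0//.
  by rewrite mulVf// gt_eqF// exprn_gt0.
have tr i : (k i)%:R <= x i / eta ^+ 2 < (k i).+1%:R.
  by rewrite ke truncn_le divr_ge0 ?exprn_ge0 ?(ltW eta0)//= truncnS_gt.
have u2 i : u k i ^+ 2 = eta ^+ 2 * (k i).+1%:R.
  by rewrite exprMn sqr_sqrtr.
have uk0 i : 0 < u k i by rewrite mulr_gt0// sqrtr_gt0 ltr0n.
have xu i : x i <= u k i ^+ 2.
  by case/andP: (tr i) => _ /ltW; rewrite u2 ler_pdivrMr ?exprn_gt0// mulrC.
have ux i : u k i <= Num.sqrt (x i) + eta.
  rewrite -(ler_pXn2r (n := 2)) ?nnegrE ?addr_ge0 ?sqrtr_ge0 ?(ltW eta0) ?(ltW (uk0 i))//.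
  rewrite u2 sqrrD sqr_sqrtr// -natr1 mulrDr mulr1 lerD2r.
  case/andP: (tr i) => + _; rewrite ler_pdivlMr ?exprn_gt0// mulrC => h.
  by rewrite (le_trans h)// lerDl mulrn_wge0// mulr_ge0 ?sqrtr_ge0// ltW.
have s1 i : Num.sqrt (x i) <= 1 by rewrite -sqrtr1 ler_wsqrtr.
under eq_bigr do rewrite mulrBl.
rewrite sumrB dir_formE// -addrA lerD2l -opprD lerN2.
(* Since [x i <= u k i ^+ 2], the quotient [x i / u k i] is at most [u k i], and no small
   denominator remains. *)
apply: (@le_trans _ _ (\sum_i u k i * nbr_sum e (u k) i)).
  apply: ler_sum => i _.
  have -> : nbr_sum e (u k) i / u k i * x i = x i / u k i * nbr_sum e (u k) i by ring.
  rewrite ler_wpM2r ?ler_pdivrMr -?expr2//.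
  by apply: sumr_ge0 => j _; rewrite mulr_ge0// ltW.
apply: (@le_trans _ _ (\sum_i (Num.sqrt (x i) * nbr_sum e (fun j => Num.sqrt (x j)) i
    + 3 * (degree e i)%:R * eta))).
  apply: ler_sum => i _; rewrite degreeE /nbr_sum !mulr_sumr mulr_suml -big_split/=.
  apply: ler_sum => j _; case: (e i j); rewrite ?mul0r ?mulr0 ?mul0r ?addr0// !mul1r mulr1.
  have := ler_pM (ltW (uk0 i)) (ltW (uk0 j)) (ux i) (ux j).
  have := s1 i; have := s1 j; have := sqrtr_ge0 (x i); have := sqrtr_ge0 (x j).
  by nra.
by rewrite big_split /= lerD2l -mulr_suml -mulr_sumr.
Qed.

End Dirichlet.

(** * The Poisson equation and perturbed supersolutions *)

Section Poisson.
Context {R : realFieldType} {V : finType}.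
Variables (e : rel V) (s : V -> V -> R).
Hypotheses (e_conn : forall i j, connect e i j).
Hypotheses (s_sym : forall i j, s i j = s j i) (s_ge0 : forall i j, 0 <= s i j)
  (s_gt0 : forall i j, e i j -> 0 < s i j).

Lemma sum_antisym (g : V -> V -> R) : (forall i j, g i j = - g j i) ->
  \sum_i \sum_j g i j = 0.
Proof.
move=> gN; set x := LHS; have : x = - x.
  rewrite {1}/x exchange_big /= -sumrN; apply: eq_bigr => i _.
  by rewrite -sumrN; apply: eq_bigr => j _.
by move=> /eqP; rewrite -addr_eq0 -mulr2n mulrn_eq0 => /eqP.
Qed.

(** The energy [\sum s i j * (h i - h j) ^+ 2] vanishes: writing [h i - h j = (h i + h j) - 2 * h j]
    for one factor gives an antisymmetric part and a multiple of the equation. So [h] is constant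
    along edges, and the graph is connected. *)
Lemma harmonic_const (h : V -> R) :
  (forall i, \sum_j s i j * (h i - h j) = 0) -> forall i j, h i = h j.
Proof.
move=> H; have E : \sum_i \sum_j s i j * (h i - h j) ^+ 2 = 0.
  transitivity (\sum_i \sum_j (s i j * (h i - h j) * (h i + h j)
     - 2 * (h j * (s i j * (h i - h j))))).
    by apply: eq_bigr => i _; apply: eq_bigr => j _; ring.
  under eq_bigr do rewrite sumrB.
  rewrite sumrB sum_antisym; last by move=> i j; rewrite s_sym; ring.
  rewrite sub0r exchange_big big1 ?oppr0// => j _.
  rewrite -mulr_sumr -mulr_sumr (_ : \sum_i _ = - \sum_i s j i * (h j - h i)).
    by rewrite H oppr0 !mulr0.
  by rewrite -sumrN; apply: eq_bigr => i _; rewrite s_sym; ring.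
have edge i j : e i j -> h i = h j.
  move=> eij; have P i' : 0 <= \sum_j s i' j * (h i' - h j) ^+ 2.
    by apply: sumr_ge0 => k _; rewrite mulr_ge0// sqr_ge0.
  have /eqP := E; rewrite psumr_eq0// => /allP/(_ i (mem_index_enum _)) /=.
  rewrite psumr_eq0 => [/allP/(_ j (mem_index_enum _)) /=|k _]; last first.
    by rewrite mulr_ge0// sqr_ge0.
  by rewrite mulf_eq0 gt_eqF ?s_gt0//= sqrf_eq0 subr_eq0 => /eqP.
move=> i j; have /connectP[p] := e_conn i j.
elim: p i => [i _ ->//|k p IH i /= /andP[/edge -> kp] jp]; exact: IH.
Qed.

Lemma poisson (f : V -> R) : \sum_i f i = 0 ->
  exists h : V -> R, forall i, \sum_j s i j * (h i - h j) = f i.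
Proof.
move=> f0.
have total (h : V -> R) : \sum_i \sum_j s i j * (h i - h j) = 0.
  by apply: sum_antisym => i j; rewrite s_sym; ring.
(* The Laplacian plus the all-ones matrix is invertible. *)
pose M : 'M[R]_#|V| := \matrix_(p, q)
  ((p == q)%:R * (\sum_j s (enum_val q) j) - s (enum_val p) (enum_val q) + 1).
have mulM (v : 'rV[R]_#|V|) (h := fun i => v 0 (enum_rank i)) q :
    (v *m M) 0 q = \sum_j s (enum_val q) j * (h (enum_val q) - h j) + \sum_j h j.
  rewrite mxE; under eq_bigr do rewrite mxE mulrDr mulrBr mulr1.
  rewrite big_split sumrB /=; congr (_ + _); last first.
    rewrite (reindex (@enum_val _ (mem V)))/=; last first.
      by exists enum_rank => i _; rewrite ?enum_valK ?enum_rankK.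
    by apply: eq_bigr => p _; rewrite /h enum_valK.
  under [RHS]eq_bigr do rewrite mulrBr.
  rewrite sumrB; congr (_ - _).
    rewrite (bigD1 q)//= eqxx mul1r [X in _ + X]big1 ?addr0; last first.
      by move=> p /negbTE ->; rewrite mul0r mulr0.
    by rewrite mulr_sumr; apply: eq_bigr => j _; rewrite /h enum_valK mulrC.
  rewrite [RHS](reindex (@enum_val _ (mem V)))/=; last first.
    by exists enum_rank => i _; rewrite ?enum_valK ?enum_rankK.
  by apply: eq_bigr => p _; rewrite /h enum_valK s_sym mulrC.
(* Summed over the vertices, the Laplacian part cancels and [#|V|] times the sum of [h] is left. So
   the all-ones term vanishes at every solution with a right side of sum zero. The vertex [i]
   witnesses that [#|V|] is not zero. *)
have sum0 (h g : V -> R) : \sum_i g i = 0 ->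
    (forall i, \sum_j s i j * (h i - h j) + \sum_j h j = g i) ->
    forall i : V, \sum_j h j = 0.
  move=> g0 H i; have : \sum_i (\sum_j s i j * (h i - h j) + \sum_j h j) = 0.
    by rewrite -[RHS]g0; apply: eq_bigr.
  rewrite big_split/= total add0r sumr_const => /eqP.
  rewrite mulrn_eq0 => /orP[|/eqP//].
  by rewrite -leqn0 leqNgt; case/negP; apply/card_gt0P; exists i.
have Mu : M \in unitmx.
  rewrite -row_free_unit; apply: inj_row_free => v vM.
  pose h i := v 0 (enum_rank i).
  have Hh i : \sum_j s i j * (h i - h j) + \sum_j h j = 0.
    by have := mulM v (enum_rank i); rewrite vM mxE enum_rankK => <-.
  have z : \sum_(i : V) (fun=> 0) i = 0 :> R by rewrite big1.
  have h0 (i : V) : \sum_j h j = 0 by exact: (sum0 h (fun=> 0) z Hh i).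
  have hc := @harmonic_const h _.
  apply/rowP => p; rewrite mxE.
  have hc' : forall i j, h i = h j.
    by apply: hc => i; have := Hh i; rewrite (h0 i) addr0.
  have := h0 (enum_val p); rewrite (eq_bigr (fun=> h (enum_val p))) => [|j _]; last exact: hc'.
  rewrite sumr_const => /eqP; rewrite mulrn_eq0 /h enum_valK => /orP[|/eqP //].
  by rewrite -leqn0 leqNgt; case/negP; apply/card_gt0P; exists (enum_val p).
pose v := (\row_p f (enum_val p)) *m invmx M.
pose h i := v 0 (enum_rank i).
have Hh i : \sum_j s i j * (h i - h j) + \sum_j h j = f i.
  have := mulM v (enum_rank i); rewrite enum_rankK => <-.
  by rewrite /v mulmxKV// mxE enum_rankK.
exists h => i; have := Hh i; by rewrite (sum0 h f f0 Hh i) addr0.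
Qed.

End Poisson.

Section Perturbation.
Context {R : realType} {V : finType}.
Variables (e : rel V) (o : V).
Hypotheses (e_sym : symmetric e) (e_conn : forall i j, connect e i j).
Hypothesis deg_gt0 : forall i, exists j, e i j.
Variable u : V -> R.
Hypothesis u_gt0 : forall i, 0 < u i.

Let q i := nbr_sum e u i / u i.
(** For the walk with rates [u j / u i] the exit rate is [q i] and the conductances [u i * u j] are
    symmetric, so [u ^+ 2] is reversible. When [u ^+ 2] has sum 1, [alpha] is the stationary jump
    rate; [\sum_i w i * u i ^+ 2 / alpha] is then the mean of the integral of [w] over one jump. *)
Let alpha := \sum_i u i * nbr_sum e u i.

Lemma nbr_sum_gt0 i : 0 < nbr_sum e u i.
Proof.
have [j ij] := deg_gt0 i.
rewrite /nbr_sum (bigD1 j)//= ij mul1r ltr_pwDl//.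
by apply: sumr_ge0 => k _; rewrite mulr_ge0// ltW.
Qed.

Lemma total_rate_gt0 : 0 < alpha.
Proof.
rewrite /alpha (bigD1 o)//= ltr_pwDl ?mulr_gt0 ?nbr_sum_gt0//.
by apply: sumr_ge0 => k _; rewrite ltW// mulr_gt0 ?nbr_sum_gt0.
Qed.

(* First-order perturbation of the Perron eigenvector: [1 + eps * h] corrects [u],
   where [h] solves the Poisson equation for [w - beta]. *)
Lemma perturbed_supersolution (w : V -> R) (eta : R) : 0 < eta ->
  let beta := (\sum_i w i * u i ^+ 2) / alpha in
  exists eps : R, exists ut : V -> R, [/\ 0 < eps, forall i, 0 < ut i,
    forall i, 0 < q i - eps * w i &
    forall i, (q i - eps * w i)^-1 * nbr_sum e ut i
              <= expR (eps * (beta + eta)) * ut i].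
Proof.
move=> eta0 beta; have a0 := total_rate_gt0.
pose s i j := (e i j)%:R * (u i * u j).
pose dd i := u i * nbr_sum e u i.
have ddE i : dd i = \sum_j s i j.
  by rewrite /dd /nbr_sum mulr_sumr; apply: eq_bigr => j _; rewrite /s; ring.
have dd0 i : 0 < dd i by rewrite mulr_gt0 ?nbr_sum_gt0.
have s_sym i j : s i j = s j i by rewrite /s e_sym; ring.
have s_ge0 i j : 0 <= s i j by rewrite !mulr_ge0// ltW.
have s_gt0 i j : e i j -> 0 < s i j by move=> h; rewrite /s h mul1r mulr_gt0.
(* [beta] is the value that makes the sum of [f] zero, which is the solvability condition of the
   Poisson equation. *)
pose f i := w i * u i ^+ 2 - beta * dd i.
have f0 : \sum_i f i = 0.
  by rewrite sumrB -mulr_sumr -/alpha /beta divfK ?subrr// gt_eqF.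
have [h Hh] := poisson e_conn s_sym s_ge0 s_gt0 f0.
have sh i : \sum_j s i j * h j = dd i * h i - f i.
  rewrite -Hh ddE mulr_suml -sumrB; apply: eq_bigr => j _; ring.
pose x i := u i ^+ 2.
have x0 i : 0 < x i by rewrite exprn_gt0.
(* Multiplied by [u i], the difference of the two sides is [eps * (eta * dd i + eps * (A1 i + eps *
   B1 i))]. The first-order terms other than [eta * dd i] cancel by the equation for [h]; [A1] and
   [B1] are the coefficients of second and third order. *)
pose A1 i := (beta + eta) * (dd i * h i - w i * x i) - w i * x i * h i.
pose B1 i := - (beta + eta) * (w i * x i * h i).
(* The three summands make [eps = (1 + K)^-1] small enough, in order, for [eta * dd i] to dominate
   the higher orders, for [q i - eps * w i] to be positive, and for [1 + eps * h i] to be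
   positive. *)
pose K := \sum_i ((`|A1 i| + `|B1 i|) / (eta * dd i) + 2 * `|w i| / q i + 2 * `|h i|).
have q0 i : 0 < q i by rewrite divr_gt0 ?nbr_sum_gt0.
have Kt i : 0 <= (`|A1 i| + `|B1 i|) / (eta * dd i).
  by apply: divr_ge0; [exact: addr_ge0|exact/ltW/mulr_gt0].
have Kt2 i : 0 <= 2 * `|w i| / q i by apply: divr_ge0; [exact: mulr_ge0|exact: ltW].
have Kt3 i : 0 <= 2 * `|h i| by rewrite mulr_ge0.
have Ki i : (`|A1 i| + `|B1 i|) / (eta * dd i) + 2 * `|w i| / q i + 2 * `|h i| <= K.
  by rewrite /K [leRHS](bigD1 i)//= lerDl sumr_ge0// => j _; rewrite !addr_ge0.
have K0 : 0 <= K by apply: sumr_ge0 => j _; rewrite !addr_ge0.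
pose eps := (1 + K)^-1.
have K1 : 0 < 1 + K by rewrite ltr_pwDl.
have eps0 : 0 < eps by rewrite invr_gt0.
have eps1 : eps <= 1 by rewrite invf_le1// lerDl.
have epsK : eps * K <= 1.
  by rewrite mulrC ler_pdivrMr// mul1r lerDr.
have eK (y : R) : y <= K -> eps * y <= 1.
  by move=> yK; apply: le_trans epsK; rewrite ler_wpM2l// ltW.
have e1 i : eps * (`|A1 i| + `|B1 i|) <= eta * dd i.
  have : eps * ((`|A1 i| + `|B1 i|) / (eta * dd i)) <= 1.
    by apply: eK; have := Ki i; have := Kt2 i; have := Kt3 i; lra.
  by rewrite mulrA ler_pdivrMr ?mul1r// mulr_gt0.
have e2 i : 2 * (eps * `|w i|) <= q i.
  have : eps * (2 * `|w i| / q i) <= 1.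
    by apply: eK; have := Ki i; have := Kt i; have := Kt3 i; lra.
  rewrite [eps * (_ / _)]mulrA ler_pdivrMr ?mul1r//; lra.
have e3 i : 2 * (eps * `|h i|) <= 1.
  have : eps * (2 * `|h i|) <= 1.
    by apply: eK; have := Ki i; have := Kt i; have := Kt2 i; lra.
  lra.
have qe i : 0 < q i - eps * w i.
  have := e2 i; have := q0 i; have := ler_norm (w i); have := normr_ge0 (w i).
  move=> n0 wn q0i h2; have : eps * w i <= eps * `|w i| by rewrite ler_wpM2l// ltW.
  have : 0 <= eps * `|w i| by rewrite mulr_ge0// ltW.
  lra.
have he i : 0 < 1 + eps * h i.
  have := e3 i; have := ler_norm (- h i); rewrite normrN => hn h2.
  have : eps * (- h i) <= eps * `|h i| by rewrite ler_wpM2l// ltW.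
  lra.
exists eps, (fun i => u i * (1 + eps * h i)); split => // [i|i]; first by rewrite mulr_gt0.
rewrite mulrC ler_pdivrMr//.
apply: (@le_trans _ _ ((1 + eps * (beta + eta)) * (u i * (1 + eps * h i)) * (q i - eps * w i)));
  last first.
  by rewrite ler_wpM2r ?(ltW (qe i))// ler_wpM2r ?expR_ge1Dx// ltW// mulr_gt0.
rewrite -(ler_pM2l (u_gt0 i)).
have -> : u i * nbr_sum e (fun j => u j * (1 + eps * h j)) i = dd i + eps * (dd i * h i - f i).
  rewrite /nbr_sum [LHS]mulr_sumr -sh ddE [X in _ + X]mulr_sumr -big_split /=.
  apply: eq_bigr => j _.
  by rewrite /s; ring.
have -> : u i * ((1 + eps * (beta + eta)) * (u i * (1 + eps * h i)) * (q i - eps * w i))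
   = (1 + eps * (beta + eta)) * (1 + eps * h i) * (dd i - eps * w i * x i).
  by rewrite /dd /x /q; field; rewrite gt_eqF.
rewrite -subr_ge0.
have -> : (1 + eps * (beta + eta)) * (1 + eps * h i) * (dd i - eps * w i * x i) -
    (dd i + eps * (dd i * h i - f i)) = eps * (eta * dd i + eps * (A1 i + eps * B1 i)).
  by rewrite /A1 /B1 /f -/(x i); ring.
rewrite mulr_ge0 ?(ltW eps0)//.
have hA : - `|A1 i| - `|B1 i| <= A1 i + eps * B1 i.
  have hB : `|eps * B1 i| <= `|B1 i|.
    by rewrite normrM gtr0_norm// ler_piMl.
  have := ler_norm (- A1 i); have := ler_norm (- (eps * B1 i)); rewrite !normrN; lra.
have := e1 i; have : eps * (- `|A1 i| - `|B1 i|) <= eps * (A1 i + eps * B1 i).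
  by rewrite ler_wpM2l// ltW.
lra.
Qed.

Lemma perturbed_path_sum (w : V -> R) (eta : R) : 0 < eta ->
  let beta := (\sum_i w i * u i ^+ 2) / alpha in
  exists eps : R, exists C : R, [/\ 0 < eps, 0 <= C,
    forall i, 0 < q i - eps * w i &
    forall n, path_sum e n (fun _ i => (q i - eps * w i)^-1) (fun=> 1) o
              <= C * expR (n%:R * (eps * (beta + eta)))].
Proof.
move=> eta0 beta; have [eps [ut [eps0 ut0 qe H]]] := perturbed_supersolution w eta0.
have C0 : 0 <= \sum_i (ut i)^-1 by apply: sumr_ge0 => i _; rewrite invr_ge0 ltW.
exists eps, ((\sum_i (ut i)^-1) * ut o); split => //; first by rewrite mulr_ge0// ltW.
move=> n; apply: (le_trans (path_sum_le (u := ut) (C := \sum_i (ut i)^-1)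
   (r := fun=> expR (eps * (beta + eta))) o _ _ _ _ _)) => //.
- by move=> k j; rewrite invr_ge0 ltW.
- move=> j; rewrite -ler_pdivrMr// mul1r (bigD1 j)//= lerDl.
  by apply: sumr_ge0 => k _; rewrite invr_ge0 ltW.
by rewrite prodr_const card_ord -expRM_natl mulrAC.
Qed.

(** [u] is fixed by the operator [q^-1 * nbr_sum], so the total mass of the Doob transform does not
    decay with [n]; the constant compares [u] with 1. *)
Lemma exact_path_sum : exists2 c : R, 0 < c &
  forall n, c <= path_sum e n (fun _ i => (q i)^-1) (fun=> 1) o.
Proof.
have U0 : 0 < \sum_i u i.
  by rewrite (bigD1 o)//= ltr_pwDl// sumr_ge0// => k _; rewrite ltW.
exists ((\sum_i u i)^-1 * u o); first by rewrite mulr_gt0// invr_gt0.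
move=> n; apply: path_sum_ge.
- by move=> k j; rewrite invr_ge0 divr_ge0 ?ltW ?nbr_sum_gt0.
- move=> j; rewrite ler_pdivrMl// mulr1 (bigD1 j)//= lerDl sumr_ge0// => k _.
  exact: ltW.
- move=> k j _; rewrite /q invf_div divfK ?lexx //.
  by rewrite gt_eqF// nbr_sum_gt0.
- by rewrite invr_ge0 ltW.
Qed.

End Perturbation.

(** * The walk *)

(* Every oriented edge is crossed for the first time at most once. *)
Lemma prod_jump_rate (R : realType) (V : finType) (e : rel V) (a : R) (y : nat -> V) n :
  0 < a -> a <= 1 -> exists2 r : R, a ^+ #|{: V * V}| <= r &
  \prod_(k < n) jump_rate e a y k (y k.+1) = r * \prod_(k < n) (e (y k) (y k.+1))%:R.
Proof.
move=> a0 a1.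
exists (\prod_(k < n) (if traversed y k (y k) (y k.+1) then 1 else a)); last first.
  rewrite -big_split /=; apply: eq_bigr => k _; rewrite /jump_rate.
  by case: (e _ _); rewrite ?mulr1 ?mulr0.
pose F := [set k : 'I_n | ~~ traversed y k (y k) (y k.+1)]%SET.
have -> : \prod_(k < n) (if traversed y k (y k) (y k.+1) then 1 else a) = a ^+ #|F|.
  rewrite -prodr_const [RHS]big_mkcond /=; apply: eq_bigr => k _.
  by rewrite inE if_neg.
have Fle : (#|F| <= #|{: V * V}|)%N.
  rewrite -(@card_in_imset _ _ (fun k : 'I_n => (y k, y k.+1)) F); first exact: max_card.
  have key (k l : 'I_n) : k \in F -> l \in F -> y k = y l -> y k.+1 = y l.+1 -> (l <= k)%N.
    rewrite !inE => _ lF ykl ykl1; rewrite leqNgt; apply: contra lF => kl.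
    by apply/existsP; exists (Ordinal kl) => /=; rewrite ykl ykl1 !eqxx.
  move=> k l kF lF [ykl ykl1]; apply/val_inj/eqP; rewrite eqn_leq /=.
  by rewrite (key l k)// (key k l).
by apply: ler_wiXn2l => //; exact: ltW.
Qed.


Section Walk.
Context {R : realType} {V : finType}.
Variables (e : rel V) (o : V) (a : R).
Hypotheses (e_sym : symmetric e) (e_irr : irreflexive e)
  (e_conn : forall i j, connect e i j).
Hypotheses (a_gt0 : 0 < a) (a_le1 : a <= 1).
Hypothesis deg_gt0 : forall i, (0 < degree e i)%N.
Context d (Omega : measurableType d) (P : probability Omega R).
Variable X : R -> Omega -> V.
Hypothesis HX : is_dORRW e o a P X.

Let mX := dORRW_measurable HX.
Let rc := dORRW_right_continuous HX.

Definition tau n w := jump_time (X^~ w) n.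
Definition pos n w := jump_chain (X^~ w) n.
Definition hold k w := fine (tau k.+1 w) - fine (tau k w).
Definition cyl n (y : nat -> V) : set Omega :=
  [set w | (tau n w < +oo)%E /\ forall k, (k <= n)%N -> pos k w = y k].

Local Notation ell t i w := (local_time (X^~ w) t i).

Lemma exit_rate_gt0 y n : 0 < exit_rate e a y n.
Proof.
apply: (lt_le_trans _ (exit_rate_ge e a_le1 y n)).
by rewrite mulr_gt0// ltr0n.
Qed.

Lemma measurable_tau n : measurable_fun setT (tau n).
Proof. exact: measurable_jump_time. Qed.

Lemma measurable_hold k : measurable_fun setT (hold k).
Proof.
by apply: measurable_funB;
  apply: (measurableT_comp (@fine_measurable R setT measurableT));
  exact: measurable_tau.
Qed.

Lemma measurable_tau_lt n (c : \bar R) : measurable [set w | (tau n w < c)%E].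
Proof.
rewrite -[X in measurable X]setTI.
apply: emeasurable_fun_infty_o => //; exact: measurable_tau.
Qed.

Lemma measurable_tau_le n (c : \bar R) : measurable [set w | (tau n w <= c)%E].
Proof.
rewrite -[X in measurable X]setTI.
apply: emeasurable_fun_infty_c => //; exact: measurable_tau.
Qed.

Lemma measurable_tau_gt n (c : \bar R) : measurable [set w | (c < tau n w)%E].
Proof.
rewrite -[X in measurable X]setTI.
apply: emeasurable_fun_o_infty => //; exact: measurable_tau.
Qed.

Lemma measurable_tau_infty n : measurable [set w | tau n w = +oo%E].
Proof.
rewrite (_ : mkset _ = ~` [set w | (tau n w < +oo)%E]).
  by apply: measurableC; exact: measurable_tau_lt.
apply/seteqP; split => w /=; first by move=> ->; rewrite ltxx.
by move/negP; rewrite -leNgt leye_eq => /eqP.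
Qed.

Lemma measurable_cyl n y : measurable (cyl n y).
Proof.
rewrite (_ : cyl n y = [set w | (tau n w < +oo)%E] `&`
  \bigcap_(k in [set k | (k <= n)%N]) [set w | pos k w = y k])//.
apply: measurableI; first exact: measurable_tau_lt.
by apply: bigcap_measurableType => k _; exact: measurable_jump_chain.
Qed.

Lemma cyl_tau_fin n y k w : cyl n y w -> (k <= n)%N -> tau k w \is a fin_num.
Proof.
move=> [Tn _] kn; apply: jump_time_fin; apply: le_lt_trans Tn.
exact: jump_time_mono.
Qed.

Lemma cyl_hold_gt0 n y k w : cyl n y w -> (k < n)%N -> 0 < hold k w.
Proof.
move=> Dw kn; have f1 := cyl_tau_fin Dw kn; have f0 := cyl_tau_fin Dw (ltnW kn).
rewrite /hold subr_gt0 -lte_fin !fineK//; apply: jump_time_lt; first exact: rc.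
by rewrite ltey_eq f0.
Qed.

Let event n y (s : nat -> R) : set Omega := [set w | forall k, (k <= n)%N ->
  jump_chain (X^~ w) k = y k /\
  (jump_time (X^~ w) k + (s k)%:E < jump_time (X^~ w) k.+1)%E].

Let measurable_event n y s : measurable (event n y s).
Proof.
rewrite (_ : event n y s = \bigcap_(k in [set k | (k <= n)%N])
  ([set w | pos k w = y k] `&` [set w | (tau k w + (s k)%:E < tau k.+1 w)%E])).
  apply: bigcap_measurableType => k _; apply: measurableI.
    exact: measurable_jump_chain.
  rewrite -[X in measurable X]setTI; apply: emeasurable_fun_lt => //.
    by apply: emeasurable_funD => //; exact: measurable_tau.
  exact: measurable_tau.
by apply/seteqP; split.
Qed.

(** With [s n = 0] the condition on the [n]-th holding time only says that [tau n] is finite, since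
    right continuity makes holding times positive. *)
Lemma cyl_eventE n y s : s n = 0 -> event n y s =
  cyl n y `&` [set w | forall k, (k < n)%N -> s k < hold k w].
Proof.
move=> sn; apply/seteqP; split => [w H|w [Dw Hs] k].
  have Dw : cyl n y w.
    split; last by move=> k /H[].
    have [_ +] := H n (leqnn n); rewrite sn adde0 => h.
    by rewrite (lt_le_trans h)// leey.
  split => // k kn; have f1 := cyl_tau_fin Dw kn; have f0 := cyl_tau_fin Dw (ltnW kn).
  have [_] := H k (ltnW kn); rewrite /hold -/(tau k w) -/(tau k.+1 w).
  by rewrite -(fineK f0) -(fineK f1) -EFinD lte_fin ltrBrDl !fineK.
rewrite leq_eqVlt => /predU1P[->|kn]; have [Tn Hy] := Dw.
  split; first exact: Hy.
  by rewrite sn adde0; apply: jump_time_lt => //; exact: rc.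
have f1 := cyl_tau_fin Dw kn; have f0 := cyl_tau_fin Dw (ltnW kn).
split; first exact/Hy/ltnW.
rewrite -/(tau k w) -/(tau k.+1 w) -(fineK f0) -(fineK f1) -EFinD lte_fin -ltrBrDl.
exact: Hs.
Qed.

Lemma walk_moment n y (c : nat -> R) : y 0%N = o ->
  (forall k, (k < n)%N -> c k < exit_rate e a y k) ->
  (\int[P]_(w in cyl n y) (expR (\sum_(k < n) c k * hold k w))%:E =
   (\prod_(k < n) (jump_rate e a y k (y k.+1) / (exit_rate e a y k - c k)))%:E)%E.
Proof.
move=> y0 cq.
rewrite (@exponential_product_moment _ _ _ P n (cyl n y) hold
  (\prod_(k < n) (jump_rate e a y k (y k.+1) / exit_rate e a y k))
  (exit_rate e a y) c).
- rewrite -big_split /=; congr _%:E; apply: eq_bigr => k _.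
  by rewrite mulrA divfK// gt_eqF// exit_rate_gt0.
- exact: measurable_cyl.
- exact: measurable_hold.
- by move=> k _; exact: exit_rate_gt0.
- exact: cq.
- by move=> w k Dw; exact: cyl_hold_gt0 Dw.
- move=> s s0; pose s' k := if k == n then 0 else s k.
  have s'0 k : 0 <= s' k by rewrite /s'; case: ifP.
  have := dORRW_law HX n y0 s'0; rewrite -/(event n y s').
  rewrite cyl_eventE ?/s' ?eqxx// mulr0 oppr0 expR0 mulr1 => E.
  transitivity (P (cyl n y `&` [set w | forall k, (k < n)%N -> s' k < hold k w])).
    congr (P (_ `&` _)); apply/seteqP; split => w /= H k kn; have := H k kn;
    by rewrite /s' ltn_eqF.
  rewrite E -big_split/=; congr _%:E; apply: eq_bigr => k _.
  by rewrite (ltn_eqF (ltn_ord k)).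
Qed.

(** Let only the last threshold [s n] grow: the law bounds the probability by [expR (- (a * s))],
    because every vertex has a neighbour and the exit rate is at least [a]. *)
Lemma jump_time_infty_null n y : y 0%N = o ->
  P (cyl n y `&` [set w | tau n.+1 w = +oo%E]) = 0%E.
Proof.
move=> y0; have mE : measurable (cyl n y `&` [set w | tau n.+1 w = +oo%E]).
  by apply: measurableI; [exact: measurable_cyl|exact: measurable_tau_infty].
have bound (s : R) : 0 <= s ->
    (P (cyl n y `&` [set w | tau n.+1 w = +oo%E]) <= (expR (- (a * s)))%:E)%E.
  move=> s0; pose s' k := if k == n then s else 0.
  have s'0 k : 0 <= s' k by rewrite /s'; case: ifP.
  apply: (@le_trans _ _ (P (event n y s'))).
    apply: le_measure; rewrite ?inE//.
    move=> w [Dw /= TS] k; rewrite leq_eqVlt => /predU1P[->|kn].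
      split; first by case: Dw => _; apply.
      rewrite -/(tau n.+1 w) TS -/(tau n w) -(fineK (cyl_tau_fin Dw (leqnn n))) -EFinD.
      exact: ltry.
    split; first by case: Dw => _; apply; exact: ltnW.
    rewrite /s' ltn_eqF// adde0; apply: jump_time_lt; first exact: rc.
    by rewrite ltey_eq (cyl_tau_fin Dw (ltnW kn)).
  rewrite (dORRW_law HX n y0 s'0) lee_fin /s' eqxx.
  rewrite -[leRHS]mul1r ler_pM ?expR_ge0//.
  - apply: prodr_ge0 => k _; rewrite mulr_ge0 ?expR_ge0// divr_ge0 ?jump_rate_ge0//.
    exact/ltW/exit_rate_gt0.
  - apply: prodr_ile1 => k _; rewrite (ltn_eqF (ltn_ord k)) mulr0 oppr0 expR0 mulr1.
    rewrite divr_ge0 ?jump_rate_ge0//= ?ler_pdivrMr ?exit_rate_gt0 ?mul1r//.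
      rewrite /exit_rate (bigD1 (y k.+1))//= lerDl.
      by apply: sumr_ge0 => j _; exact: jump_rate_ge0.
    exact/ltW/exit_rate_gt0.
  - rewrite ler_expR lerN2 ler_wpM2r//; apply: (le_trans _ (exit_rate_ge e a_le1 y n)).
    by rewrite ler_peMr ?ler1n ?deg_gt0// ltW.
set p := P _ in bound *; have p0 : (0 <= p)%E by exact: measure_ge0.
apply/eqP; rewrite eq_le p0 andbT; apply/lee_addgt0Pr => r r0; rewrite add0e.
apply: le_trans (bound (r^-1 / a) _) _; first by rewrite divr_ge0 ?invr_ge0 ?ltW.
rewrite lee_fin mulrC divfK ?gt_eqF// expRN invf_ple ?posrE ?expR_gt0//.
by rewrite (le_trans _ (expR_ge1Dx _))// lerDr.
Qed.

(** * Exponential Markov inequalities summed over histories *)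

Lemma cyl_partition n (B : set Omega) : measurable B ->
  (forall w, B w -> (tau n w < +oo)%E) ->
  P B = (\sum_(h : n.-tuple V) P (B `&` cyl n (history o h)))%E.
Proof.
move=> mB Bfin; rewrite -measure_finType.
- rewrite -setI_bigcupr; congr (P _); apply/esym/setIidPl => w Bw.
  exists [tuple pos k.+1 w | k < n] => //; split; first exact: Bfin.
  case=> [|k] kn; first by rewrite history0 /pos /jump_chain /=; exact: dORRW_start HX w.
  by rewrite /history /= (nth_map (Ordinal kn)) ?size_enum_ord// nth_enum_ord.
- by move=> h; apply: measurableI => //; exact: measurable_cyl.
- move=> h h' _ _ [w [[_ [_ H]] [_ [_ H']]]]; apply: val_inj.
  apply: (@eq_from_nth _ o); first by rewrite !size_tuple.
  move=> k; rewrite size_tuple => kn.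
  by have := H k.+1 kn; rewrite (H' k.+1 kn).
Qed.

Lemma markov_cyl n y (c : nat -> R) (B : set Omega) (K : R) :
  measurable B -> B `<=` cyl n y -> 0 <= K ->
  (forall w, B w -> 1 <= K * expR (\sum_(k < n) c k * hold k w)) ->
  (P B <= K%:E * \int[P]_(w in cyl n y) (expR (\sum_(k < n) c k * hold k w))%:E)%E.
Proof.
move=> mB BD K0 HB.
have mF : measurable_fun (cyl n y) (fun w => (expR (\sum_(k < n) c k * hold k w))%:E).
  apply: measurable_funTS; apply/measurable_EFinP.
  apply: measurableT_comp; first exact: measurable_expR.
  by apply: measurable_sum => k; apply: measurable_funM => //; exact: measurable_hold.
have mD := measurable_cyl n y.
rewrite -ge0_integralZl_EFin//.
rewrite -[P B]mul1e -integral_cst//.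
apply: (@le_trans _ _ (\int[P]_(w in B) (K%:E * (expR (\sum_(k < n) c k * hold k w))%:E))%E).
  apply: ge0_le_integral => //.
  exact: measurable_funeM (measurable_funS mD BD mF).
apply: ge0_subset_integral => //; first exact: measurable_funeM.
by move=> w _; rewrite mule_ge0 ?lee_fin ?expR_ge0.
Qed.

Lemma tau_infty_null n :
  P ([set w | (tau n w < +oo)%E] `&` [set w | tau n.+1 w = +oo%E]) = 0%E.
Proof.
have mI := measurable_tau_infty n.+1.
rewrite (@cyl_partition n); last by move=> w [].
  apply: big1 => h _; have := jump_time_infty_null n (history0 o h).
  move=> Hz; apply/eqP; rewrite -measure_le0 -[leRHS]Hz.
  apply: le_measure; rewrite ?inE.
  - apply: measurableI; last exact: measurable_cyl.
    by apply: measurableI => //; exact: measurable_tau_lt.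
  - by apply: measurableI => //; exact: measurable_cyl.
  - by move=> w [[_ ?] ?].
by apply: measurableI => //; exact: measurable_tau_lt.
Qed.

Lemma cyl_moment_le n (c : nat -> V -> R) (i : V) (h : n.-tuple V) :
  (forall k j, (k < n)%N -> c k j < a * (degree e j)%:R) ->
  (\int[P]_(w in cyl n (history o h))
     (expR (\sum_(k < n) c k (history o h k) * hold k w))%:E
   <= (\prod_(k < n) ((e (history o h k) (history o h k.+1))%:R *
         (a * (degree e (history o h k))%:R - c k (history o h k))^-1))%:E)%E.
Proof.
move=> ca; rewrite (walk_moment (c := fun k => c k (history o h k)))//.
  rewrite lee_fin; apply: ler_prod => k _.
  have cak := ca k (history o h k) (ltn_ord k).
  have pos1 : 0 < a * (degree e (history o h k))%:R - c k (history o h k).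
    by rewrite subr_gt0.
  have pos2 : a * (degree e (history o h k))%:R - c k (history o h k)
     <= exit_rate e a (history o h) k - c k (history o h k).
    by rewrite lerD2r exit_rate_ge.
  have pos3 := lt_le_trans pos1 pos2.
  rewrite divr_ge0 ?jump_rate_ge0 ?(ltW pos3)//=.
  apply: ler_pM; rewrite ?jump_rate_ge0 ?invr_ge0 ?(ltW pos3) ?jump_rate_le//.
  by rewrite lef_pV2.
move=> k kn; apply: lt_le_trans (ca _ _ kn) _; exact: exit_rate_ge.
Qed.

(** What the upper bounds use of the walk: a pointwise exponential inequality on [B] becomes a bound
    by a [path_sum], where the reinforcement is visible only in [a * degree]. *)
Lemma cyl_sum_le n (c : nat -> V -> R) (B : set Omega) (K : R) :
  measurable B -> (forall w, B w -> (tau n w < +oo)%E) -> 0 <= K ->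
  (forall k j, (k < n)%N -> c k j < a * (degree e j)%:R) ->
  (forall w, B w -> 1 <= K * expR (\sum_(k < n) c k (pos k w) * hold k w)) ->
  (P B <= (K * path_sum e n (fun k j => (a * (degree e j)%:R - c k j)^-1)
     (fun=> 1) o)%:E)%E.
Proof.
move=> mB Bfin K0 ca HB; rewrite (cyl_partition mB Bfin) -sum_history mulr_sumr -sumEFin.
apply: lee_sum => h _.
apply: (@le_trans _ _ (K%:E * \int[P]_(w in cyl n (history o h))
   (expR (\sum_(k < n) c k (history o h k) * hold k w))%:E)%E).
  apply: (markov_cyl (c := fun k => c k (history o h k))) => //.
  - by apply: measurableI => //; exact: measurable_cyl.
  - move=> w [/HB + [_ H]]; congr (_ <= _ * expR _).
    by apply: eq_bigr => k _; rewrite H// ltnW.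
by rewrite mulr1 EFinM lee_wpmul2l ?lee_fin//; exact: cyl_moment_le.
Qed.

Lemma weighted_local_time n t (c : V -> R) w :
  (tau n w <= t%:E)%E -> (t%:E <= tau n.+1 w)%E ->
  \sum_i c i * ell t i w =
  \sum_(k < n) c (pos k w) * hold k w + c (pos n w) * (t - fine (tau n w)).
Proof.
move=> Tt tT.
have delta (y : R) j : \sum_i c i * (y * (j == i)%:R) = c j * y.
  rewrite (bigD1 j)//= eqxx mulr1 big1 ?addr0// => i ij.
  by rewrite eq_sym (negbTE ij) !mulr0.
under eq_bigr => i _.
  rewrite (local_time_holding (measurable_occupation mX rc w) i Tt tT).
  rewrite mulrDr mulr_sumr; over.
rewrite big_split /= delta exchange_big /=; congr (_ + _).
by apply: eq_bigr => k _; rewrite delta.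
Qed.

Lemma sum_hold n w : \sum_(k < n) hold k w = fine (tau n w).
Proof.
rewrite -(big_mkord xpredT (fun k => hold k w)).
rewrite (telescope_sumr (fun k => fine (tau k w)))//.
by rewrite /tau/= subr0.
Qed.

(** Non-explosion. With the weight [expR (- s * tau N)] each step contributes at most
    [deg / (a * deg + s)], which is at most 1/2 since [s >= 2 * deg] at every vertex. *)
Lemma tau_le_prob : exists2 s : R, 0 <= s & forall N t, 0 <= t ->
  (P [set w | (tau N w <= t%:E)%E] <= (expR (s * t) * 2^-1 ^+ N)%:E)%E.
Proof.
pose s : R := 2 * \sum_i (degree e i)%:R.
have degs i : 2 * (degree e i)%:R <= s.
  by rewrite ler_pM2l// (bigD1 i)//= lerDl; apply: sumr_ge0.
have s0 : 0 <= s by rewrite mulr_ge0// sumr_ge0.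
exists s => // N t t0.
have mE := measurable_tau_le N t%:E.
have adeg i : 0 < a * (degree e i)%:R by rewrite mulr_gt0// ltr0n.
apply: le_trans (cyl_sum_le (n := N) (c := fun _ _ => - s)
  (K := expR (s * t)) mE _ _ _ _) _.
- by move=> w /= /le_lt_trans; apply; exact: ltry.
- exact: expR_ge0.
- by move=> k j _; rewrite (le_lt_trans _ (adeg j))// oppr_le0.
- move=> w /= Tt; rewrite -mulr_sumr sum_hold -expRD -[leLHS]expR0 ler_expR.
  rewrite mulNr -mulrBr mulr_ge0// subr_ge0 -lee_fin fineK//.
  by apply: jump_time_fin; exact: le_lt_trans (ltry t).
rewrite lee_fin ler_wpM2l ?expR_ge0//.
apply: (le_trans (path_sum_le (u := fun=> 1) (C := 1) (r := fun=> 2^-1) o _ _ _ _ _)) => //.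
- by move=> k j; rewrite invr_ge0 opprK addr_ge0// ltW.
- by move=> j; rewrite mulr1.
- move=> k j _; rewrite mulr1 /nbr_sum.
  under eq_bigr do rewrite mulr1.
  rewrite -degreeE opprK mulrC ler_pdivrMr; last by rewrite ltr_pwDl.
  rewrite -ler_pdivrMl ?invr_gt0// invrK (le_trans (degs j))// lerDr.
  exact: ltW.
by rewrite mul1r mulr1 prodr_const card_ord.
Qed.

(** The event is cut according to the number [n] of jumps before [t]. Lowering the weight by [delta]
    costs [expR (delta * t)] and gives each jump a ratio [rho < 1], so that the series over [n]
    converges uniformly in [t]. *)
Lemma upper_weight (u : V -> R) (delta : R) : (forall i, 0 < u i) -> 0 < delta ->
  exists2 C : R, 0 <= C & forall (t m : R) (E : set Omega), 0 <= t ->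
  measurable E ->
  (forall w, E w -> m * t <=
     \sum_i (a * (degree e i)%:R - nbr_sum e u i / u i) * ell t i w) ->
  (P E <= (C * expR (- (t * (m - delta))))%:E)%E.
Proof.
move=> u0 d0.
pose q i := nbr_sum e u i / u i.
have q0 i : 0 <= q i.
  by rewrite divr_ge0 ?(ltW (u0 i))// sumr_ge0// => j _; rewrite mulr_ge0// ltW.
pose c i := a * (degree e i)%:R - q i - delta.
have adeg i : 0 < a * (degree e i)%:R by rewrite mulr_gt0// ltr0n.
have ca i : c i < a * (degree e i)%:R by rewrite /c -addrA -opprD gtrBl ltr_wpDl.
(* The holding time that contains [t] has only been observed up to [t], while moments are known for
   complete holding times. The truncation at 0 makes the weight monotone in the length, and [rho']
   is the price of this single step. *)
pose cp i := Num.max (c i) 0.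
have cpa i : cp i < a * (degree e i)%:R by rewrite gt_max ca adeg.
pose B := \sum_i q i.
have qB i : q i <= B by rewrite /B (bigD1 i)//= lerDl sumr_ge0.
have B0 : 0 <= B by exact: sumr_ge0.
pose rho := B / (B + delta).
have Bd : 0 < B + delta by rewrite ltr_wpDl.
have rho0 : 0 <= rho by rewrite divr_ge0// ltW.
have rho1 : rho < 1 by rewrite ltr_pdivrMr// mul1r ltrDl.
pose rho' := \sum_i (a * (degree e i)%:R - cp i)^-1 * q i.
have rho'i i : (a * (degree e i)%:R - cp i)^-1 * q i <= rho'.
  rewrite /rho' (bigD1 i)//= lerDl sumr_ge0// => j _.
  by rewrite mulr_ge0// invr_ge0 subr_ge0 ltW.
have rho'0 : 0 <= rho'.
  by apply: sumr_ge0 => j _; rewrite mulr_ge0// invr_ge0 subr_ge0 ltW.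
pose C0 := \sum_i (u i)^-1.
have C00 : 0 <= C0 by apply: sumr_ge0 => i _; rewrite invr_ge0 ltW.
have C0u i : 1 <= C0 * u i.
  rewrite -ler_pdivrMr// mul1r /C0 (bigD1 i)//= lerDl sumr_ge0// => j _.
  by rewrite invr_ge0 ltW.
pose K := C0 * rho' * u o.
have K0 : 0 <= K by rewrite !mulr_ge0// ltW.
exists (K / (1 - rho)); first by rewrite divr_ge0// subr_ge0 ltW.
move=> t m E t0 mE HE.
set x := expR _.
have step n : (P (E `&` [set w | (tau n w <= t%:E)%E] `&` [set w | (t%:E < tau n.+1 w)%E])
    <= (x * K * rho ^+ n)%:E)%E.
  set B1 := (X in P X).
  have mB1 : measurable B1.
    apply: measurableI; last exact: measurable_tau_gt.
    by apply: measurableI => //; exact: measurable_tau_le.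
  (* The complete [n]-th holding time enters the weight, so [tau n.+1] has to be finite; [N1] is the
     null set where it is not. *)
  pose N1 := [set w | (tau n w < +oo)%E] `&` [set w | tau n.+1 w = +oo%E].
  have mfin := measurable_tau_lt n.+1 +oo%E.
  have mN1 : measurable N1.
    by apply: measurableI; [exact: measurable_tau_lt|exact: measurable_tau_infty].
  have mB2 : measurable (B1 `&` [set w | (tau n.+1 w < +oo)%E]) by exact: measurableI.
  apply: (@le_trans _ _ (P ((B1 `&` [set w | (tau n.+1 w < +oo)%E]) `|` N1))).
    apply: le_measure; rewrite ?inE//; first exact: measurableU.
    move=> w Bw; have [h|] := boolP (tau n.+1 w < +oo)%E; first by left.
    rewrite -leNgt leye_eq => /eqP h; right; split => //=.
    by case: Bw => [[_ /= /le_lt_trans]] + _; apply; exact: ltry.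
  apply: (@le_trans _ _ (P (B1 `&` [set w | (tau n.+1 w < +oo)%E]) + P N1)%E).
    exact: measureU2.
  rewrite (tau_infty_null) adde0.
  pose cc k j := if (k < n)%N then c j else cp j.
  apply: le_trans (cyl_sum_le (n := n.+1) (c := cc)
    (K := x) mB2 _ _ _ _) _.
  - by move=> w [].
  - exact: expR_ge0.
  - by move=> k j _; rewrite /cc; case: ifP.
  - move=> w [[[Ew /= Tt] tT] Tfin].
    rewrite -expRD -[leLHS]expR0 ler_expR addrC subr_ge0.
    have Tn1 : tau n.+1 w \is a fin_num by exact: jump_time_fin.
    have Tn : tau n w \is a fin_num.
      by apply: jump_time_fin; exact: le_lt_trans (ltry t).
    have Hm := HE w Ew; rewrite (weighted_local_time _ Tt (ltW tT)) in Hm.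
    rewrite big_ord_recr /= {2}/cc ltnn.
    rewrite (eq_bigr (fun k : 'I_n => (a * (degree e (pos k w))%:R - q (pos k w)) * hold k w
        - delta * hold k w)); last first.
      by move=> k _; rewrite /cc ltn_ord /c mulrBl.
    rewrite sumrB -mulr_sumr sum_hold.
    have tn : 0 <= t - fine (tau n w) by rewrite subr_ge0 -lee_fin fineK.
    have tn1 : t - fine (tau n w) <= hold n w.
      by rewrite /hold lerD2r -lee_fin fineK// ltW.
    have : c (pos n w) * (t - fine (tau n w)) <= cp (pos n w) * hold n w.
      apply: (@le_trans _ _ (cp (pos n w) * (t - fine (tau n w)))).
        by rewrite ler_wpM2r// le_max lexx.
      by rewrite ler_wpM2l// le_max lexx orbT.
    rewrite /c /q in Hm *; move: Hm; set A1 := \sum_(k < n) _; nra.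
  rewrite lee_fin -mulrA ler_wpM2l ?expR_ge0//.
  apply: (le_trans (path_sum_le (u := u) (C := C0)
    (r := fun k => if (k < n)%N then rho else rho') o _ _ _ _ _)) => //.
  - by move=> k j; rewrite invr_ge0 subr_ge0 /cc ltW//; case: ifP.
  - by move=> k _; case: ifP.
  - move=> k j kn; rewrite /cc.
    have -> : nbr_sum e u j = q j * u j by rewrite /q divfK// gt_eqF.
    rewrite mulrA; case: ifP => _; last by rewrite ler_wpM2r// ltW.
    rewrite ler_wpM2r ?(ltW (u0 j))//.
    have -> : a * (degree e j)%:R - c j = q j + delta by rewrite /c; ring.
    rewrite mulrC ler_pdivrMr ?ltr_wpDl// /rho mulrAC ler_pdivlMr//.
    by rewrite !mulrDr mulrC lerD2l ler_wpM2r// ltW.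
  rewrite big_ord_recr /= ltnn (eq_bigr (fun=> rho)); last first.
    by move=> k _; rewrite ltn_ord.
  rewrite prodr_const card_ord /K le_eqVlt; apply/orP; left; apply/eqP; ring.
have part N : (P (E `&` [set w | (t%:E < tau N w)%E])
    <= (x * K * \sum_(n < N) rho ^+ n)%:E)%E.
  have mlt n := measurable_tau_gt n t%:E.
  have mle n := measurable_tau_le n t%:E.
  elim: N => [|N IH].
    rewrite big_ord0 mulr0 (_ : _ `&` _ = set0) ?measure0//.
    apply/seteqP; split => // w [_ /=].
    by rewrite /tau /= lte_fin ltNge t0.
  apply: (@le_trans _ _ (P ((E `&` [set w | (t%:E < tau N w)%E]) `|`
      (E `&` [set w | (tau N w <= t%:E)%E] `&` [set w | (t%:E < tau N.+1 w)%E])))).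
    apply: le_measure; rewrite ?inE.
    - exact: measurableI.
    - by apply: measurableU; [exact: measurableI|apply: measurableI => //; exact: measurableI].
    - by move=> w [Ew /= tT]; have [h|h] := leP (tau N w) t%:E; [right|left].
  apply: le_trans (measureU2 _ _ _) _; first exact: measurableI.
    by apply: measurableI => //; exact: measurableI.
  by rewrite big_ord_recr /= mulrDr EFinD leeD.
(* The bound [part] covers paths with fewer than [N] jumps up to [t], uniformly in [N].
   Non-explosion removes the rest as [N] grows with [t] fixed. *)
have [s s0 Hs] := tau_le_prob.
have geo N : \sum_(n < N) rho ^+ n <= (1 - rho)^-1.
  rewrite -[leRHS]mul1r ler_pdivlMr ?subr_gt0//.
  have -> : (\sum_(n < N) rho ^+ n) * (1 - rho) = 1 - rho ^+ N.
    by rewrite -[RHS]opprB subrX1; ring.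
  by rewrite gerBl exprn_ge0.
have tot N : (P E <= (K / (1 - rho) * x + expR (s * t) * 2^-1 ^+ N)%:E)%E.
  have mlt := measurable_tau_gt N t%:E.
  have mle := measurable_tau_le N t%:E.
  apply: (@le_trans _ _ (P ((E `&` [set w | (t%:E < tau N w)%E]) `|`
      [set w | (tau N w <= t%:E)%E]))).
    apply: le_measure; rewrite ?inE//.
    - by apply: measurableU => //; exact: measurableI.
    - by move=> w Ew; have [h|h] := leP (tau N w) t%:E; [right|left].
  apply: le_trans (measureU2 _ _ _) _ => //; first exact: measurableI.
  rewrite EFinD leeD ?Hs//; apply: le_trans (part N) _.
  have -> : K / (1 - rho) * x = x * K * (1 - rho)^-1 by ring.
  by rewrite lee_fin ler_wpM2l// mulr_ge0 ?expR_ge0.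
apply/lee_addgt0Pr => r r0.
have [N HN] : exists N : nat, expR (s * t) * 2^-1 ^+ N <= r.
  exists (Num.truncn (expR (s * t) / r)).+1.
  rewrite exprVn ler_pdivrMr ?exprn_gt0// -ler_pdivrMl// mulrC.
  apply: (le_trans (ltW (truncnS_gt _))).
  by rewrite -natrX ler_nat ltnW// ltn_expl.
by apply: le_trans (tot N) _; rewrite -EFinD lee_fin lerD2l.
Qed.

(** * Exponential bounds for the occupation vector *)

Definition occupation t w : {ptws V -> R} := fun i => t^-1 * local_time (X^~ w) t i.

Lemma occupation_simplex t w : 0 < t -> simplex (occupation t w).
Proof.
move=> t0; split=> [i|].
  by rewrite mulr_ge0 ?invr_ge0 ?(ltW t0) ?local_time_ge0//;
    exact: measurable_occupation mX rc w.
rewrite -mulr_sumr (sum_local_time (measurable_occupation mX rc w) (ltW t0)).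
by rewrite mulVf// gt_eqF.
Qed.

Lemma measurable_occupation_time t i :
  measurable_fun setT (fun w => occupation t w i).
Proof.
apply: measurable_funM => //.
exact: measurable_local_time mX rc t i.
Qed.

(** At each outcome some test function of the grid is within [delta / 2] of the Dirichlet form, so
    [E] is covered by finitely many events, each bounded by [upper_weight] with the other
    [delta / 2]. *)
Lemma occupation_upper_bound (kappa delta : R) : 0 < delta ->
  exists2 C : R, 0 <= C & forall t (E : set Omega), 0 < t -> measurable E ->
  (forall w, E w -> kappa <= dir_form e (occupation t w)
     - (1 - a) * \sum_i (degree e i)%:R * occupation t w i) ->
  (P E <= (C * expR (- (t * (kappa - delta))))%:E)%E.
Proof.
move=> delta0; have d2 : 0 < delta / 2 by rewrite divr_gt0.
have [N [u [u0 Hu]]] := dir_form_grid e_sym e_irr d2.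
have /choice[C HC] : forall k, exists C : R, 0 <= C /\
  forall (t m : R) (E : set Omega), 0 <= t ->
  measurable E ->
  (forall w, E w -> m * t <=
     \sum_i (a * (degree e i)%:R - nbr_sum e (u k) i / u k i) * local_time (X^~ w) t i) ->
  (P E <= (C * expR (- (t * (m - delta / 2))))%:E)%E.
  by move=> k; have [C] := upper_weight (u0 k) d2; exists C.
exists (\sum_k C k); first by apply: sumr_ge0 => k _; have [] := HC k.
move=> t E t0 mE HE.
pose S k w := \sum_i (a * (degree e i)%:R - nbr_sum e (u k) i / u k i) * local_time (X^~ w) t i.
have mS k : measurable_fun setT (S k).
  apply: measurable_sum => i; apply: measurable_funM => //.
  exact: measurable_local_time mX rc t i.
pose F k := E `&` [set w | (kappa - delta / 2) * t <= S k w].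
have mF k : measurable (F k).
  apply: measurableI => //; rewrite -[X in measurable X]setTI.
  have : measurable_fun setT (fun w => (kappa - delta / 2) * t <= S k w).
    exact: measurable_fun_ler.
  by move=> /(_ measurableT [set true]); exact.
apply: (@le_trans _ _ (\sum_k P (F k))%E).
  apply: measure_le_sum => // w Ew.
  have xS := occupation_simplex w t0; have [k Hk] := Hu _ xS.
  exists k; first by rewrite mem_index_enum.
  split => //=; have := HE w Ew => H.
  have -> : S k w = t * (\sum_i ((degree e i)%:R - nbr_sum e (u k) i / u k i)
     * occupation t w i - (1 - a) * \sum_i (degree e i)%:R * occupation t w i).
    rewrite mulr_sumr -sumrB mulr_sumr; apply: eq_bigr => i _.
    by rewrite /occupation; field; rewrite !gt_eqF.
  by rewrite mulrC ler_wpM2l ?(ltW t0)//; lra.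
rewrite mulr_suml -sumEFin; apply: lee_sum => k _.
have [_ /(_ t (kappa - delta / 2) (F k) (ltW t0) (mF k))] := HC k.
have -> : kappa - delta / 2 - delta / 2 = kappa - delta by field.
by apply => w [].
Qed.

(** The hypothesis concerns the random time [tau n], the conclusion the time [t]. Summing over [V]
    gives [|t - tau n| <= #|V| * eta * t], and local times are 1-Lipschitz; this accounts for the
    factor [#|V| + 1]. *)
Lemma cyl_close n y w (x : V -> R) t eta i : cyl n y w -> 0 < t -> \sum_j x j = 1 ->
  (forall j, `|\sum_(k < n) hold k w * (y k == j)%:R - t * x j| <= eta * t) ->
  `|occupation t w i - x i| <= #|V|.+1%:R * eta.
Proof.
move=> Dw t0 x1 HL; have [_ Hy] := Dw.
pose L j := \sum_(k < n) hold k w * (y k == j)%:R.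
have Tf : tau n w \is a fin_num by apply: cyl_tau_fin Dw _.
have mZ := measurable_occupation mX rc w.
have LE j : local_time (X^~ w) (fine (tau n w)) j = L j.
  rewrite (local_time_holding mZ (n := n)) ?fineK//; last by apply: jump_time_le.
  rewrite subrr mul0r addr0; apply: eq_bigr => k _.
  by rewrite -/(pos k w) Hy// ltnW.
have T0 : 0 <= fine (tau n w) by rewrite fine_ge0// jump_time_ge0.
have TL : fine (tau n w) = \sum_j L j.
  rewrite -(sum_local_time mZ T0); exact: eq_bigr.
have Tt : `|t - fine (tau n w)| <= #|V|%:R * (eta * t).
  have {1}-> : t = \sum_j t * x j by rewrite -mulr_sumr x1 mulr1.
  rewrite distrC TL -sumrB.
  apply: le_trans (ler_norm_sum _ _ _) _.
  apply: (@le_trans _ _ (\sum_(j : V) eta * t)); first by apply: ler_sum => j _; exact: HL.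
  by rewrite sumr_const mulr_natl.
have lip : `|local_time (X^~ w) t i - L i| <= `|t - fine (tau n w)|.
  rewrite -LE; have [h|/ltW h] := leP (fine (tau n w)) t.
    by rewrite [leRHS]ger0_norm ?subr_ge0//; exact: local_time_lipschitz.
  rewrite distrC [leRHS]distrC [leRHS]ger0_norm ?subr_ge0//.
  by apply: local_time_lipschitz => //; exact: ltW.
have -> : occupation t w i - x i = t^-1 * (local_time (X^~ w) t i - t * x i).
  by rewrite /occupation; field; rewrite gt_eqF.
rewrite normrM gtr0_norm ?invr_gt0// ler_pdivrMl//.
have -> : local_time (X^~ w) t i - t * x i = (local_time (X^~ w) t i - L i) + (L i - t * x i).
  by ring.
apply: le_trans (ler_normD _ _) _.
have -> : t * (#|V|.+1%:R * eta) = #|V|%:R * (eta * t) + eta * t.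
  by rewrite -natr1; ring.
by rewrite lerD ?HL// (le_trans lip).
Qed.

(** A change of measure without a new measure: the left side is the mass that the weight [c] gives
    to this history. Where the path is good the density is at most [K]; elsewhere it is dominated by
    one of the weights [cb], whose moments are explicit too. *)
Lemma cyl_lower n y (B : finType) (c : nat -> R) (cb : B -> nat -> R) (K : R)
  (Kb : B -> R)
  (E : set Omega) : measurable E -> y 0%N = o -> 0 <= K -> (forall b, 0 <= Kb b) ->
  (forall k, (k < n)%N -> c k < exit_rate e a y k) ->
  (forall b k, (k < n)%N -> cb b k < exit_rate e a y k) ->
  (forall w, cyl n y w ->
    (E w /\ \sum_(k < n) c k * hold k w <= ln K /\ 0 < K) \/
    exists b, expR (\sum_(k < n) c k * hold k w)
       <= Kb b * expR (\sum_(k < n) cb b k * hold k w)) ->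
  \prod_(k < n) (jump_rate e a y k (y k.+1) / (exit_rate e a y k - c k)) <=
  K * fine (P (E `&` cyl n y)) +
  \sum_b Kb b * \prod_(k < n) (jump_rate e a y k (y k.+1) / (exit_rate e a y k - cb b k)).
Proof.
move=> mE y0 K0 Kb0 cq cbq H.
have mD := measurable_cyl n y.
have mexp (c' : nat -> R) : measurable_fun (cyl n y)
    (fun w => (expR (\sum_(k < n) c' k * hold k w))%:E).
  apply: measurable_funTS; apply/measurable_EFinP.
  apply: measurableT_comp; first exact: measurable_expR.
  by apply: measurable_sum => k; apply: measurable_funM => //; exact: measurable_hold.
have m1 : measurable_fun (cyl n y) (fun w => (K%:E * (\1_E w)%:E)%E).
  apply: measurable_funTS; apply: measurable_funeM; apply/measurable_EFinP.
  exact: measurable_indic.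
have mb b : measurable_fun (cyl n y)
    (fun w => ((Kb b)%:E * (expR (\sum_(k < n) cb b k * hold k w))%:E)%E).
  exact: measurable_funeM.
have : (\int[P]_(w in cyl n y) (expR (\sum_(k < n) c k * hold k w))%:E <=
   \int[P]_(w in cyl n y) (K%:E * (\1_E w)%:E +
     \sum_b (Kb b)%:E * (expR (\sum_(k < n) cb b k * hold k w))%:E))%E.
  apply: ge0_le_integral => //.
  - by apply: emeasurable_funD => //; apply: emeasurable_sum => b _; exact: mb.
  - move=> w Dw; have S0 b : (0 <= (Kb b)%:E * (expR (\sum_(k < n) cb b k * hold k w))%:E)%E.
      by rewrite mule_ge0 ?lee_fin ?expR_ge0.
    have [[Ew [cK Kp]]|[b Hb]] := H w Dw.
      apply: (@le_trans _ _ (K%:E * (\1_E w)%:E)%E).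
        rewrite indicE mem_set// mule1 lee_fin.
        by rewrite -[K in leRHS](lnK Kp) ler_expR.
      by rewrite leeDl// sume_ge0.
    apply: (@le_trans _ _ ((Kb b)%:E * (expR (\sum_(k < n) cb b k * hold k w))%:E)%E).
      by rewrite -EFinM lee_fin.
    rewrite (bigD1 b)//= addeCA leeDl// adde_ge0//; last exact: sume_ge0.
    by rewrite mule_ge0 ?lee_fin.
rewrite (walk_moment y0 cq) ge0_integralD//; last 3 first.
- by move=> w _; rewrite mule_ge0 ?lee_fin.
- by move=> w _; apply: sume_ge0 => b _; rewrite mule_ge0 ?lee_fin ?expR_ge0.
- by apply: emeasurable_sum => b _; exact: mb.
rewrite ge0_integral_sum//; last by move=> b w _; rewrite mule_ge0 ?lee_fin ?expR_ge0.
rewrite ge0_integralZl_EFin//; last exact/measurable_EFinP/measurable_indic.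
rewrite integral_indic//.
under [X in (_ + X)%E]eq_bigr => b _.
  rewrite ge0_integralZl_EFin//.
  rewrite (walk_moment y0 (cbq b)) -EFinM; over.
rewrite sumEFin => Hle; rewrite -lee_fin EFinD EFinM fineK ?fin_num_measure//.
exact: measurableI.
Qed.

(** * The Doob transform by the square root of [x] and the lower bound *)

Section LowerBound.
Variable x : V -> R.
Hypotheses (x_gt0 : forall i, 0 < x i) (x_sum : \sum_i x i = 1).

Let u i := Num.sqrt (x i).
Let q i := nbr_sum e u i / u i.
Let v i := (degree e i)%:R - q i.
Let alpha := \sum_i u i * nbr_sum e u i.

Let u_gt0 i : 0 < u i. Proof. by rewrite sqrtr_gt0. Qed.

Let nbr_ex i : exists j, e i j.
Proof.
by have := deg_gt0 i; rewrite /degree => /card_gt0P[j]; rewrite inE; exists j.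
Qed.

Let drift_energy : \sum_i v i * x i = dir_form e x.
Proof.
rewrite dir_formE//; last by move=> i; exact: ltW.
rewrite -sumrB; apply: eq_bigr => i _; rewrite mulrBl; congr (_ - _).
rewrite -[in LHS](sqr_sqrtr (ltW (x_gt0 i))) -/(u i) /q; field.
by rewrite gt_eqF.
Qed.

Let sg (b : bool) : R := if b then 1 else -1.
(** The index [b] names a vertex and a side, above or below, on which its occupation time can
    deviate. *)
Let wt (b : V * bool) j : R := sg b.2 * (j == b.1)%:R.

(* On a history along which the occupation times are not close to [x], one of the
   finitely many perturbed exponential weights exceeds the unperturbed one. *)
Let cyl_dichotomy (eta1 eta t : R) n y w (eps : V * bool -> R) :
  0 < t -> cyl n y w -> #|V|.+1%:R * eta1 <= eta -> (forall b, 0 < eps b) ->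
  ((forall i, `|occupation t w i - x i| <= eta) /\
   \sum_(k < n) (exit_rate e a y k - q (y k)) * hold k w
     <= t * (dir_form e x + eta1 * \sum_i `|v i|)) \/
  exists b, expR (\sum_(k < n) (exit_rate e a y k - q (y k)) * hold k w) <=
    expR (- (eps b * (sg b.2 * x b.1 * t + eta1 * t))) *
    expR (\sum_(k < n) (exit_rate e a y k - (q (y k) - eps b * wt b (y k))) * hold k w).
Proof.
move=> t0 Dw Veta eps0.
pose L j := \sum_(k < n) hold k w * (y k == j)%:R.
have hold0 (k : 'I_n) : 0 <= hold k w by rewrite ltW// (cyl_hold_gt0 Dw).
have [close|] := pselect (forall b : V * bool, sg b.2 * (L b.1 - t * x b.1) <= eta1 * t).
  left.
  have HL j : `|L j - t * x j| <= eta1 * t.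
    have := close (j, true); have := close (j, false).
    by rewrite /= mul1r mulN1r ler_norml lerNl => -> ->.
  split=> [i|]; first exact: le_trans (cyl_close i Dw t0 x_sum HL) Veta.
  apply: (@le_trans _ _ (\sum_(k < n) v (y k) * hold k w)).
    apply: ler_sum => k _; rewrite ler_wpM2r// lerD2r.
    exact: exit_rate_le.
  have -> : \sum_(k < n) v (y k) * hold k w = \sum_i v i * L i.
    rewrite /L; under [RHS]eq_bigr do rewrite mulr_sumr.
    rewrite exchange_big /=; apply: eq_bigr => k _.
    rewrite (bigD1 (y k))//= eqxx mulr1 big1 ?addr0// => i ik.
    by rewrite eq_sym (negbTE ik) !mulr0.
  rewrite -drift_energy mulr_sumr -big_split /= mulr_sumr; apply: ler_sum => i _.
  have -> : v i * L i = t * (v i * x i) + v i * (L i - t * x i) by ring.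
  rewrite [leRHS]mulrDr lerD2l (le_trans (ler_norm _))// normrM.
  have -> : t * (eta1 * `|v i|) = `|v i| * (eta1 * t) by ring.
  by rewrite ler_wpM2l.
move=> /existsNP[b /negP]; rewrite -ltNge => far; right; exists b.
rewrite -expRD ler_expR.
rewrite [X in _ + X](eq_bigr (fun k : 'I_n => (exit_rate e a y k - q (y k)) * hold k w
   + eps b * sg b.2 * (hold k w * (y k == b.1)%:R))); last first.
  by move=> k _; rewrite /wt; ring.
rewrite big_split /= -mulr_sumr -/(L b.1) addrCA lerDl.
have := ltW far; rewrite -(ler_pM2l (eps0 b)); lra.
Qed.

Let q_gt0 i : 0 < q i.
Proof. by rewrite divr_gt0// (nbr_sum_gt0 nbr_ex u_gt0). Qed.

(** Sums [cyl_lower] over all histories. First crossings of edges cost one factor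
    [a ^+ #|{: V * V}|], which does not depend on [n] or [t]. *)
Let history_lower (eta1 eta t : R) n (eps : V * bool -> R) (E : set Omega) :
  0 < t -> #|V|.+1%:R * eta1 <= eta -> (forall b, 0 < eps b) ->
  (forall b i, 0 < q i - eps b * wt b i) -> measurable E ->
  (forall w, (forall i, `|occupation t w i - x i| <= eta) -> E w) ->
  a ^+ #|{: V * V}| * (path_sum e n (fun _ i => (q i)^-1) (fun=> 1) o -
    \sum_b expR (- (eps b * (sg b.2 * x b.1 * t + eta1 * t))) *
      path_sum e n (fun _ i => (q i - eps b * wt b i)^-1) (fun=> 1) o)
  <= expR (t * (dir_form e x + eta1 * \sum_i `|v i|)) * fine (P E).
Proof.
move=> t0 Veta eps0 qe mE HE.
set K := expR (t * _); pose Kb b := expR (- (eps b * (sg b.2 * x b.1 * t + eta1 * t))).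
pose w0 (g : V -> R) (h : n.-tuple V) : R :=
  \prod_(k < n) ((e (history o h k) (history o h k.+1))%:R * (g (history o h k))^-1).
have psE g : path_sum e n (fun _ i => (g i)^-1) (fun=> 1) o = \sum_h w0 g h.
  by rewrite -sum_history; apply: eq_bigr => h _; rewrite mulr1.
have step h : a ^+ #|{: V * V}| *
    (w0 q h - \sum_b Kb b * w0 (fun i => q i - eps b * wt b i) h)
    <= K * fine (P (E `&` cyl n (history o h))).
  have [r ra Hr] := prod_jump_rate e (history o h) n a_gt0 a_le1.
  (* Here the exit rate cancels in the denominator. All weights share the numerator [r], the only
     trace of the reinforcement on this history. *)
  have prodE g : \prod_(k < n) (jump_rate e a (history o h) k (history o h k.+1) /
      (exit_rate e a (history o h) k - (exit_rate e a (history o h) k - g (history o h k))))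
      = r * w0 g h.
    under eq_bigr do rewrite opprB addrC subrK.
    by rewrite big_split /= Hr -mulrA -big_split.
  have := @cyl_lower n (history o h) _
    (fun k => exit_rate e a (history o h) k - q (history o h k))
    (fun b k => exit_rate e a (history o h) k - (q (history o h k) - eps b * wt b (history o h k)))
    K Kb E mE (history0 o h) (expR_ge0 _) (fun b => expR_ge0 _).
  rewrite prodE; under eq_bigr do rewrite (prodE (fun i => q i - eps _ * wt _ i)).
  move=> H; have {H} : r * (w0 q h - \sum_b Kb b * w0 (fun i => q i - eps b * wt b i) h)
      <= K * fine (P (E `&` cyl n (history o h))).
    rewrite mulrBr mulr_sumr lerBlDr.
    under [X in _ <= _ + X]eq_bigr do rewrite mulrCA.
    apply: H.
    - by move=> k _; rewrite gtrBl.
    - by move=> b k _; rewrite gtrBl.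
    - move=> w Dw; have [[h1 h2]|h1] := cyl_dichotomy t0 Dw Veta eps0; [left|by right].
      by split; [exact: HE|rewrite /K expRK expR_gt0].
  (* Replacing [r] by its lower bound is legitimate only for a nonnegative bracket; otherwise the
     claim is trivial. *)
  set br := (w0 q h - _) => rbr.
  have [br0|br0] := leP 0 br; first by apply: le_trans rbr; rewrite ler_wpM2r.
  apply: (@le_trans _ _ 0); first by rewrite mulr_ge0_le0 ?exprn_ge0 ?(ltW a_gt0) ?(ltW br0).
  by rewrite mulr_ge0 ?expR_ge0 ?fine_ge0.
rewrite psE; under [X in _ - X]eq_bigr => b _ do
  rewrite (psE (fun i => q i - eps b * wt b i)) mulr_sumr.
rewrite exchange_big /= -sumrB mulr_sumr.
apply: (@le_trans _ _ (\sum_h K * fine (P (E `&` cyl n (history o h))))).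
  by apply: ler_sum => h _; exact: step.
rewrite -mulr_sumr ler_wpM2l ?expR_ge0//.
have mT := measurable_tau_lt n +oo%E.
have mET : measurable (E `&` [set w | (tau n w < +oo)%E]) by exact: measurableI.
apply: (@le_trans _ _ (fine (P (E `&` [set w | (tau n w < +oo)%E])))).
  rewrite (cyl_partition (n := n) mET); last by move=> w [].
  rewrite -sum_fine; last by move=> h _; rewrite fin_num_measure//;
    apply: measurableI => //; exact: measurable_cyl.
  rewrite le_eqVlt; apply/orP; left; apply/eqP; apply: eq_bigr => h _.
  congr (fine (P _)); apply/seteqP; split => w; first by move=> [Ew [h1 h2]].
  by move=> [[]].
rewrite fine_le ?fin_num_measure//.
by apply: le_measure; rewrite ?inE.
Qed.

Lemma occupation_lower_bound (eta : R) : 0 < eta ->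
  exists2 c : R, 0 < c & exists2 t0 : R, 0 < t0 & forall t (E : set Omega),
  t0 <= t -> measurable E ->
  (forall w, (forall i, `|occupation t w i - x i| <= eta) -> E w) ->
  c * expR (- (t * (dir_form e x + eta))) <= fine (P E).
Proof.
move=> eta0; pose sv := \sum_i `|v i|.
have sv0 : 0 <= sv by apply: sumr_ge0.
(* One denominator serves both losses: [#|V| + 1] from [cyl_close] and the sum of the [|v i|] from
   the bound on the density. *)
pose eta1 := eta / (#|V|.+1%:R + sv).
have den0 : 0 < #|V|.+1%:R + sv by rewrite ltr_wpDr// ltr0n.
have eta10 : 0 < eta1 by rewrite divr_gt0.
have Veta : #|V|.+1%:R * eta1 <= eta.
  by rewrite /eta1 mulrA ler_pdivrMr// mulrC ler_wpM2l ?(ltW eta0)// lerDl.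
have seta : eta1 * sv <= eta.
  by rewrite /eta1 mulrAC ler_pdivrMr// ler_wpM2l ?(ltW eta0)// lerDr.
have al0 : 0 < alpha by rewrite /alpha (total_rate_gt0 o nbr_ex u_gt0).
(* Over about [alpha * t] jumps the perturbation error [eta1 / (2 * alpha)] adds up to
   [eta1 * t / 2], half of the margin [eta1 * t]. The other half is the decay rate [lam], and the
   extra exponential in [Cb] absorbs the rounding of [n]. *)
have eta20 : 0 < eta1 / (2 * alpha) by rewrite divr_gt0// mulr_gt0.
have /choice[f Hf] : forall b : V * bool, exists f : R * R,
    [/\ 0 < f.1, 0 <= f.2, forall i, 0 < q i - f.1 * wt b i &
    forall n, path_sum e n (fun _ i => (q i - f.1 * wt b i)^-1) (fun=> 1) o
       <= f.2 * expR (n%:R * (f.1 * (sg b.2 * x b.1 / alpha + eta1 / (2 * alpha))))].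
  move=> b; have [eps [C [h1 h2 h3 h4]]] :=
    perturbed_path_sum o e_sym e_conn nbr_ex u_gt0 (wt b) eta20.
  exists (eps, C); split => // n; move: (h4 n).
  rewrite (_ : \sum_i wt b i * u i ^+ 2 = sg b.2 * x b.1)//.
  rewrite (bigD1 b.1)//= /wt eqxx mulr1 sqr_sqrtr ?(ltW (x_gt0 _))// big1 ?addr0// => i ib.
  by rewrite (negbTE ib) mulr0 mul0r.
have [c0 c00 Hc0] := exact_path_sum o nbr_ex u_gt0.
pose Cb b := (f b).2 * expR ((f b).1 * (x b.1 / alpha)).
have Cb0 b : 0 <= Cb b by have [_ f2 _ _] := Hf b; rewrite mulr_ge0// expR_ge0.
pose lam b := (f b).1 * eta1 / 2.
have lam0 b : 0 < lam b by have [f1 _ _ _] := Hf b; rewrite divr_gt0// mulr_gt0.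
pose N : R := #|{: V * bool}|%:R.
have N0 : 0 < N by rewrite ltr0n; apply/card_gt0P; exists (o, true).
(* With [expR (- y) <= y^-1], this makes each of the [N] bad terms at most [c0 / (2 * N)], so
   together they leave half of the mass [c0]. *)
pose t0 := 1 + \sum_b 2 * N * Cb b / (c0 * lam b).
have tb b : 0 <= 2 * N * Cb b / (c0 * lam b).
  apply: divr_ge0; last exact/ltW/mulr_gt0.
  by rewrite mulr_ge0// mulr_ge0// ltW.
exists (a ^+ #|{: V * V}| * (c0 / 2)); first by rewrite mulr_gt0 ?exprn_gt0 ?divr_gt0.
exists t0; first by rewrite ltr_pwDl// sumr_ge0.
move=> t E tt mE HE.
have t1 : 0 < t by apply: lt_le_trans tt; rewrite ltr_pwDl// sumr_ge0.
pose n := Num.truncn (alpha * t).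
have at0 : 0 <= alpha * t by rewrite mulr_ge0 ?(ltW al0) ?(ltW t1).
have n1 : n%:R <= alpha * t by rewrite truncn_le.
have n2 : alpha * t <= n%:R + 1 by rewrite natr1 ltW// truncnS_gt.
have eps0 b : 0 < (f b).1 by case: (Hf b).
have qe b i : 0 < q i - (f b).1 * wt b i by case: (Hf b).
have := history_lower n t1 Veta eps0 qe mE HE.
set K := expR _; set J := path_sum _ _ _ _ _; set bad := \sum_b _ => HK.
have Jc : c0 <= J by exact: Hc0.
have badle : bad <= c0 / 2.
  apply: (@le_trans _ _ (\sum_(b : V * bool) c0 / 2 / N)); last first.
    by rewrite sumr_const -[leLHS]mulr_natr divfK// gt_eqF.
  apply: ler_sum => b _; have [f1 f2 _ Hb] := Hf b.
  apply: (@le_trans _ _ (Cb b * expR (- (lam b * t)))).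
    apply: le_trans (ler_wpM2l (expR_ge0 _) (Hb n)) _.
    rewrite /Cb mulrCA -[leRHS]mulrA ler_wpM2l// -!expRD ler_expR.
    have xa : 0 < x b.1 / alpha by rewrite divr_gt0.
    have e1 : n%:R * (sg b.2 * x b.1 / alpha) <= sg b.2 * x b.1 * t + x b.1 / alpha.
      have xat : x b.1 / alpha * (alpha * t) = x b.1 * t by field; rewrite gt_eqF.
      rewrite -mulrA /sg; case: (b.2); rewrite ?mul1r ?mulN1r.
        have := ler_wpM2l (ltW xa) n1; lra.
      have := ler_wpM2l (ltW xa) n2; lra.
    have e2 : n%:R * (eta1 / (2 * alpha)) <= eta1 * t / 2.
      apply: le_trans (ler_wpM2r (ltW eta20) n1) _.
      by rewrite le_eqVlt; apply/orP; left; apply/eqP; field; rewrite gt_eqF.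
    have := lerD (ler_wpM2l (ltW f1) e1) (ler_wpM2l (ltW f1) e2); rewrite /lam; lra.
  rewrite ler_pdivlMr//.
  have lt0 : 0 < lam b * t by rewrite mulr_gt0.
  have tbt : 2 * N * Cb b / (c0 * lam b) <= t.
    apply: le_trans tt; rewrite /t0 (bigD1 b)//= addrCA lerDl addr_ge0// sumr_ge0//.
  have hE : expR (- (lam b * t)) <= (lam b * t)^-1.
    rewrite expRN lef_pV2 ?posrE ?expR_gt0//.
    by apply: le_trans (expR_ge1Dx _); rewrite lerDr.
  apply: (@le_trans _ _ (Cb b * (lam b * t)^-1 * N)).
    by rewrite ler_wpM2r ?(ltW N0)// ler_wpM2l.
  rewrite mulrAC ler_pdivrMr//.
  have -> : c0 / 2 * (lam b * t) = t * (c0 * lam b) / 2 by ring.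
  rewrite ler_pdivlMr// (_ : Cb b * N * 2 = 2 * N * Cb b); last by ring.
  by rewrite -ler_pdivrMr// mulr_gt0.
have K0 : 0 < K by exact: expR_gt0.
have M0 : 0 < a ^+ #|{: V * V}| by rewrite exprn_gt0.
have HK2 : a ^+ #|{: V * V}| * (c0 / 2) <= K * fine (P E).
  by apply: le_trans HK; rewrite ler_pM2l//; lra.
apply: (@le_trans _ _ (a ^+ #|{: V * V}| * (c0 / 2) * K^-1)).
  rewrite ler_wpM2l ?mulr_ge0 ?divr_ge0 ?(ltW M0) ?(ltW c00)// /K -expRN ler_expR lerN2.
  by rewrite ler_wpM2l ?(ltW t1)// lerD2l.
by rewrite mulrC ler_pdivrMl.
Qed.

End LowerBound.
End Walk.

(** * Large deviations *)

Section Limits.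
Local Open Scope ereal_scope.
Context {R : realType}.
Implicit Types (f : R -> \bar R) (y : \bar R).

Lemma limf_esup_le f y : (\forall t \near +oo%R, f t <= y) ->
  limf_esup f (pinfty_nbhs R) <= y.
Proof.
move=> H; rewrite limf_esupE; apply: ge_ereal_inf; exists (ereal_sup (f @` [set t | f t <= y])).
  by exists [set t | f t <= y].
by apply: ge_ereal_sup => _ [t ft <-].
Qed.

Lemma limf_einf_ge f y : (\forall t \near +oo%R, y <= f t) ->
  y <= limf_einf f (pinfty_nbhs R).
Proof.
move=> H; rewrite limf_einfE; apply: le_ereal_sup_tmp.
exists (ereal_inf (f @` [set t | y <= f t])); first by exists [set t | y <= f t].
by apply: le_ereal_inf_tmp => _ [t ft <-].
Qed.

(** Half of [delta] absorbs [ln (C + 1) / t]. The quantifier over [p] stands inside the limit so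
    that the threshold on [t] does not depend on the probability. *)
Lemma lne_upper (C kappa delta : R) : (0 < delta)%R -> (0 <= C)%R ->
  \forall t \near +oo%R, forall p : R, (0 <= p)%R ->
    (p <= C * expR (- (t * (kappa - delta / 2))))%R ->
    (t^-1)%:E * lne p%:E <= (- kappa + delta)%:E.
Proof.
move=> d0 C0; near=> t => q q0 qC.
have t0 : (0 < t)%R by near: t; apply: nbhs_pinfty_gt; exact: num_real.
have [->|q1] := eqVneq q 0%R.
  by rewrite le0_lneNy// gt0_muleNy ?leNye// lte_fin invr_gt0.
have {q0}q1 : (0 < q)%R by rewrite lt_neqAle eq_sym q1.
rewrite lne_EFin// -EFinM lee_fin ler_pdivrMl//.
have C1 : (0 < C + 1)%R by rewrite ltr_wpDl.
apply: (@le_trans _ _ (ln ((C + 1) * expR (- (t * (kappa - delta / 2)))))).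
  rewrite ler_ln ?posrE ?mulr_gt0 ?expR_gt0//.
  by rewrite (le_trans qC)// ler_wpM2r ?expR_ge0// lerDl.
rewrite lnM ?posrE ?expR_gt0// expRK.
have : (2 * ln (C + 1) / delta <= t)%R by near: t; apply: nbhs_pinfty_ge; exact: num_real.
by rewrite ler_pdivrMr//; lra.
Unshelve. all: by end_near. Qed.

Lemma lne_lower (c D delta : R) : (0 < delta)%R -> (0 < c)%R ->
  \forall t \near +oo%R, forall p : R,
    (c * expR (- (t * (D + delta / 2))) <= p)%R ->
    (- (D + delta))%:E <= (t^-1)%:E * lne p%:E.
Proof.
move=> d0 c0; near=> t => p cp.
have t0 : (0 < t)%R by near: t; apply: nbhs_pinfty_gt; exact: num_real.
have ce : (0 < c * expR (- (t * (D + delta / 2))))%R by rewrite mulr_gt0 ?expR_gt0.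
have p0 : (0 < p)%R by exact: lt_le_trans cp.
rewrite lne_EFin// -EFinM lee_fin ler_pdivlMl//.
apply: (@le_trans _ _ (ln (c * expR (- (t * (D + delta / 2)))))); last first.
  by rewrite ler_ln ?posrE.
rewrite lnM ?posrE ?expR_gt0// expRK.
have : (2 * - ln c / delta <= t)%R by near: t; apply: nbhs_pinfty_ge; exact: num_real.
by rewrite ler_pdivrMr//; lra.
Unshelve. all: by end_near. Qed.

End Limits.

Lemma rel_interior_box (R : realType) (V : finType) (A : set {ptws V -> R}) x :
  A `<=` @simplex R V -> rel_interior A x -> A x /\ exists2 eta : R, 0 < eta &
    forall g : V -> R, simplex g -> (forall i, `|g i - x i| <= eta) -> A g.
Proof.
move=> AS Ax; have Axx : A x by exact: nbhs_subspace_singleton Ax.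
split => //; move: Ax; rewrite /rel_interior /interior /=.
rewrite -[nbhs _]/(nbhs_subspace _) -nbhs_subspace_in; last exact: AS.
move=> /nbhs_ptws_box[eta eta0 H]; exists (eta / 2); first by rewrite divr_gt0.
move=> g Sg gx; apply: H => // i; rewrite distrC (le_lt_trans (gx i))//.
by rewrite ltr_pdivrMr// ltr_pMr// ltr1n.
Qed.

Lemma rel_closure_sub (R : realType) (V : finType) (A : set {ptws V -> R}) :
  A `<=` rel_closure A.
Proof. exact: (@subset_closure (subspace (@simplex R V))). Qed.

Lemma DirE (R : realType) (V : finType) (e : rel V) (x : {ptws V -> R}) :
  (forall i, 0 < x i) -> Dir e x = (dir_form e x)%:E.
Proof. by move=> x0; rewrite /Dir; case: ifP => // /negbT/forallP; case. Qed.

Lemma Dir_ge0 (R : realType) (V : finType) (e : rel V) (x : {ptws V -> R}) :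
  (0 <= Dir e x)%E.
Proof.
rewrite /Dir; case: ifP => // _; rewrite lee_fin sumr_ge0// => p _.
exact: sqr_ge0.
Qed.

Lemma connected_degree_gt0 (V : finType) (e : rel V) :
  (forall i j, connect e i j) -> (1 < #|V|)%N -> forall i, (0 < degree e i)%N.
Proof.
move=> e_conn V1 i; have /card_gt0P[j] : (0 < #|predC1 i|)%N.
  by rewrite cardC1 -subn1 subn_gt0.
rewrite !inE => ij; have /connectP[[|k p] /= ] := e_conn i j.
  by move=> _ ji; rewrite ji eqxx in ij.
by move=> /andP[ik _] _; apply/card_gt0P; exists k; rewrite inE.
Qed.

Theorem theorem1p11 (R : realType) (a : R) (a_gt0 : 0 < a) (a_le1 : a <= 1)
  (V : finType) (e : rel V) (e_sym : symmetric e) (e_irr : irreflexive e)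
  (e_conn : forall i j : V, connect e i j) (o : V)
  (d : measure_display) (Omega : measurableType d) (P : probability Omega R)
  (X : R -> Omega -> V) (X_dORRW : is_dORRW e o a P X)
  (A : set {ptws V -> R}) (A_borel : <<s @open {ptws V -> R} >> A)
  (A_simplex : A `<=` @simplex R V)
  (A_pos : forall x, A x -> forall i, 0 < x i) :
  let logP (t : R) : \bar R :=
    ((t^-1)%:E *
      lne (P [set w | A (fun i : V => (t^-1 * local_time (X^~ w) t i)%R)]))%E in
  (- ereal_inf [set Dir e x | x in rel_interior A]
     <= limf_einf logP (pinfty_nbhs R))%E /\
  (limf_esup logP (pinfty_nbhs R)
     <= (1 - a)%:E *
          ereal_sup [set (\sum_(i : V) (degree e i)%:R * x i)%:E
                    | x in rel_closure A]
        - ereal_inf [set Dir e x | x in rel_closure A])%E.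
Proof.
move=> logP; pose E t := [set w | A (occupation X t w)].
have mE t : measurable (E t).
  apply: (@measurable_preimage_ptws _ _ _ _ (occupation X t) A) => // i.
  exact: measurable_occupation_time X_dORRW t i.
have PfinE t : P (E t) = (fine (P (E t)))%:E by rewrite fineK// fin_num_measure.
have logPE t : logP t = ((t^-1)%:E * lne (fine (P (E t)))%:E)%E by rewrite -PfinE.
have V0 : (0 < #|V|)%N by apply/card_gt0P; exists o.
have deg_gt0 : (1 < #|V|)%N -> forall i, (0 < degree e i)%N.
  exact: connected_degree_gt0.
(* A single vertex has degree 0 and escapes the bounds above, but there the simplex is one point and
   the event is certain. *)
have full x : A x -> (#|V| <= 1)%N -> forall t, 0 < t -> E t = setT.
  move=> Ax /card_le1_eqP Veq t t0; apply/seteqP; split => // w _; rewrite /E /=.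
  suff -> : occupation X t w = x by [].
  have one (y : {ptws V -> R}) : simplex y -> forall i, y i = 1.
    move=> [_ y1] i; rewrite -y1 (bigD1 i)//= big1 ?addr0// => j ji.
    by rewrite (Veq j i) ?eqxx in ji.
  apply/funext => i; rewrite (one x (A_simplex _ Ax)).
  exact: one (occupation_simplex X_dORRW w t0) i.
have t_gt0 : \forall t \near +oo, (0 : R) < t.
  by apply: nbhs_pinfty_gt; exact: num_real.
split.
  rewrite leeNl; apply: le_ereal_inf_tmp => _ [x Ax <-].
  have [Axx [eta eta0 box]] := rel_interior_box A_simplex Ax.
  rewrite leeNl; have [V1|V1] := leqP #|V| 1.
    apply: limf_einf_ge; near=> t; have tp : 0 < t by near: t.
    rewrite logPE (full x)//.
    by rewrite fineK ?fin_num_measure// probability_setT lne1 mule0 leeNl oppe0 Dir_ge0.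
  rewrite (DirE _ (A_pos _ Axx)); apply/lee_subgt0Pr => delta delta0.
  rewrite -EFinN -EFinB -opprD; apply: limf_einf_ge.
  pose eta' := Num.min eta (delta / 2).
  have eta'0 : 0 < eta' by rewrite lt_min eta0 divr_gt0.
  have [_ x1] := A_simplex _ Axx.
  have [c c0 [t0 t00 H]] := occupation_lower_bound e_sym e_irr e_conn a_gt0 a_le1
    (deg_gt0 V1) X_dORRW (A_pos _ Axx) x1 eta'0.
  have Htp := lne_lower (dir_form e x) delta0 c0.
  near=> t; rewrite logPE; have tp : 0 < t by near: t.
  have : forall p : R, c * expR (- (t * (dir_form e x + delta / 2))) <= p ->
      ((- (dir_form e x + delta))%:E <= (t^-1)%:E * lne p%:E)%E by near: t.
  apply; have tt : t0 <= t by near: t; apply: nbhs_pinfty_ge; exact: num_real.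
  apply: (le_trans _ (H t (E t) tt (mE t) _)).
    rewrite ler_wpM2l ?(ltW c0)// ler_expR lerN2 ler_wpM2l ?(ltW tp)// lerD2l.
    by rewrite /eta' ge_min lexx orbT.
  move=> w Hw; apply: box; first exact: (occupation_simplex X_dORRW w tp).
  by move=> i; rewrite (le_trans (Hw i))// /eta' ge_min lexx.
(* For empty [A] the logarithm is [-oo], which lies below the right side whatever the conventions
   make of it. *)
have [A0|/set0P[x0 Ax0]] := eqVneq A set0.
  apply: (le_trans _ (leNye _)); apply: limf_esup_le; near=> t.
  rewrite logPE (_ : E t = set0); last by rewrite /E A0.
  rewrite measure0 le0_lneNy// gt0_muleNy ?leNye// lte_fin invr_gt0.
  by near: t.
(* On [E t] the occupation vector lies in [A], so both functionals are evaluated at points of [A]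
   and then weakened to the closure by inclusion. *)
have clA := @rel_closure_sub R V A.
set S := ereal_sup _; set I := ereal_inf _.
have I_le x : A x -> (I <= (dir_form e x)%:E)%E.
  by move=> Ax; rewrite -(DirE e (A_pos _ Ax)); apply: ereal_inf_lbound; exists x => //; exact: clA.
have I_ge0 : (0 <= I)%E by apply: le_ereal_inf_tmp => _ [x _ <-]; exact: Dir_ge0.
have S_ge x : A x -> (((1 - a) * \sum_i (degree e i)%:R * x i)%:E <= (1 - a)%:E * S)%E.
  move=> Ax; rewrite EFinM lee_wpmul2l ?lee_fin ?subr_ge0//.
  by apply: ereal_sup_ubound; exists x => //; exact: clA.
have S0 : (0 <= (1 - a)%:E * S)%E.
  apply: le_trans (S_ge _ Ax0); rewrite lee_fin mulr_ge0 ?subr_ge0// sumr_ge0// => i _.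
  by rewrite mulr_ge0// ltW// (A_pos _ Ax0).
have If : I = (fine I)%:E.
  rewrite fineK// ge0_fin_numE//; exact: le_lt_trans (I_le _ Ax0) (ltry _).
have [V1|V1] := leqP #|V| 1.
  have Iz : I = 0%E.
    apply/eqP; rewrite eq_le I_ge0 andbT (le_trans (I_le _ Ax0))// lee_fin.
    rewrite /dir_form big_pred0// => -[i j] /=.
    by move/card_le1_eqP: V1 => /(_ i j isT isT) ->; rewrite e_irr.
  rewrite Iz sube0; apply: le_trans S0; apply: limf_esup_le; near=> t.
  have tp : 0 < t by near: t.
  rewrite logPE (full x0)//.
  by rewrite fineK ?fin_num_measure// probability_setT lne1 mule0.
(* Finiteness of the supremum is not established: the value [+oo] makes the bound trivial, and [S0]
   excludes [-oo]. *)
move: (S_ge) S0; case: ((1 - a)%:E * S)%E => [s| |] // Ss _; last first.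
  by rewrite If /= leey.
rewrite If -EFinB; apply/lee_addgt0Pr => delta delta0; rewrite -EFinD.
apply: limf_esup_le.
have [C C0 HC] := occupation_upper_bound e_sym e_irr a_gt0 a_le1 (deg_gt0 V1) X_dORRW
  (fine I - s) (divr_gt0 delta0 (ltr0Sn R 1)).
have Htp := lne_upper (fine I - s) delta0 C0.
near=> t; rewrite logPE; have tp : 0 < t by near: t.
have : forall p : R, 0 <= p ->
    p <= C * expR (- (t * (fine I - s - delta / 2))) ->
    ((t^-1)%:E * lne p%:E <= (- (fine I - s) + delta)%:E)%E by near: t.
rewrite opprB; apply; first by rewrite fine_ge0.
rewrite -lee_fin -PfinE; apply: HC => // w Ew.
by rewrite lerB// -lee_fin ?Ss// -If I_le.
Unshelve. all: by end_near. Qed.
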